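(* Let $\mathcal{N}=(Q,Act,\delta)$ be a one-counter net, with planes, $HF,VF,SF$, $\alpha_P$, $\ell_P$, $\mathrm{mind},\mathrm{maxd},\mathrm{spand}$, $\leq_L,\leq_R$, $\mathcal{P}_{ms}$, and neighbourhoods as defined in the context. Then: (1) For each $P\in SF$, $\alpha_P=\Delta_y/\Delta_x$ where $\Delta_x,\Delta_y$ are integers in $[1,|\mathcal{P}_{ms}(\alpha_P)|]$. (2) Let $VF\cup SF=\{P_1,\dots,P_z\}$ with $P_1\leq_L P_2\leq_L\dots\leq_L P_z$, and let $\sigma_L(i)$ be the number of equivalence classes of $\approx_L$ represented in $\{P_1,\dots,P_i\}$. Then for each $i\in[1,z]$, every point of $\mathrm{rnb}_{\sigma_L(i)}(\ell_{P_i})$ is white in $P_i$. (3) Let $HF\cup SF=\{P_1,\dots,P_z\}$ with $P_1\leq_R P_2\leq_R\dots\leq_R P_z$, and let $\sigma_R(i)$ be the number of equivalence classes of $\approx_R$ represented in $\{P_1,\dots,P_i\}$. Then for each $i\in[1,z]$, every point of $\mathrm{lnb}_{\sigma_R(i)}(\ell_{P_i})$ is black in $P_i$. (4) There is a polynomial $pol$, independent of the net $\mathcal{N}$, such that: if $P\in HF$ and $f_P(n)<\infty$ then $f_P(n)\leq pol(|Q|)$; and if $P\in VF$ and $f_P(n)<\max\{f_P(n')\mid n'\in\mathbb{N}\}$ then $n\leq pol(|Q|)$.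
   Context: A one-counter net is $\mathcal{N}=(Q,Act,\delta)$ with finite $Q$, $Act$ and rules $\delta\subseteq Q\times Act\times\{-1,0,1\}\times Q$; its LTS has states $q(m)\in Q\times\mathbb{N}$ with $q(m)\xrightarrow{a}q'(n)$ iff $(q,a,n-m,q')\in\delta$; $\preceq$ is simulation preorder. For each $(p,q)\in Q\times Q$ there is a plane $P=P_{\langle p,q\rangle}$ (a copy of $\mathbb{R}\times\mathbb{R}$, with first coordinate $m$ horizontal, second coordinate $n$ vertical); a point $(m,n)\in\mathbb{N}^2$ is black in $P$ if $p(m)\preceq q(n)$ and white otherwise. The frontier function $f_P(n)$ is $\infty$ if $p(m)\preceq q(n)$ for all $m$, $-1$ if $p(0)\not\preceq q(n)$, and $\max\{m\mid p(m)\preceq q(n)\}$ otherwise. $HF$ is the set of planes with $f_P(n)=\infty$ for some $n$; $VF$ is the set of planes not in $HF$ with $f_P$ bounded by a constant; $SF$ the remaining planes. A line $\ell$ with slope $\alpha\in\mathbb{R}\setminus\{0\}$ is $\ell(x)=\alpha x+c$ with inverse $\ell^{-1}$; horizontal lines have slope $0$; vertical lines have slope $\infty$ and are given by $\ell^{-1}(y)=c$. The signed distance $\mathrm{dist}((m,n),\ell)$ is the Euclidean distance, taken negative if $(m,n)$ lies to the left of $\ell$ (i.e. $m<\ell^{-1}(n)$). It is known that for each $P\in SF$ there is a unique $\alpha_P\in\mathbb{Q}_+$ such that the distances of the frontier points $(f_P(n),n)$ from the line $\ell_P(x)=\alpha_P x$ are bounded. For $P\in HF$ put $\alpha_P=0$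 and $\ell_P$ the horizontal axis; for $P\in VF$ put $\alpha_P=\infty$ and $\ell_P$ the vertical axis ($\ell_P^{-1}(y)=0$). For $P\in VF\cup SF$: $\mathrm{mind}(P)=\min\{r\mid r=\mathrm{dist}((f_P(n),n),\ell_P)$ for infinitely many $n\}$, $\mathrm{maxd}(P)=\max\{r\mid r=\mathrm{dist}((f_P(n),n),\ell_P)$ for infinitely many $n\}$; for $P\in HF$: $\mathrm{mind}(P)=\mathrm{maxd}(P)=-\min\{n\mid f_P(n)=\infty\}$; $\mathrm{spand}(P)=\mathrm{maxd}(P)-\mathrm{mind}(P)$. Preorders (with $\infty$ greater than every rational): $P\leq_L P'$ iff $\alpha_P>\alpha_{P'}$, or $\alpha_P=\alpha_{P'}$ and $\mathrm{mind}(P)\leq\mathrm{mind}(P')$; $P\leq_R P'$ iff $\alpha_P<\alpha_{P'}$, or $\alpha_P=\alpha_{P'}$ and $\mathrm{maxd}(P)\geq\mathrm{maxd}(P')$; $\approx_L,\approx_R$ are the induced equivalences. For a slope $\alpha$: $\mathcal{P}(\alpha)=\{P\mid\alpha_P=\alpha\}$, and $\mathcal{P}_{ms}(\alpha)$ is the set of $P\in\mathcal{P}(\alpha)$ with maximal $\mathrm{spand}(P)$ in $\mathcal{P}(\alpha)$. For $\alpha\in\mathbb{Q}_+$, $\mathrm{step}(\alpha)=1+1/\alpha$. For a line $\ell$ of slope $\alpha\in\mathbb{Q}_+$ and $k\in\mathbb{N}$: $\mathrm{rnb}_k(\ell)=\{(m,n)\in\mathbb{N}^2\mid \ell^{-1}(n)+(k-1)\mathrm{step}(\alpha)<m\leq\ell^{-1}(n)+k\,\mathrm{step}(\alpha)\}$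 and $\mathrm{lnb}_k(\ell)=\{(m,n)\in\mathbb{N}^2\mid \ell^{-1}(n)-k\,\mathrm{step}(\alpha)\leq m<\ell^{-1}(n)-(k-1)\mathrm{step}(\alpha)\}$. For a vertical line $\ell$: $\mathrm{rnb}_k(\ell)=\{(m,n)\in\mathbb{N}^2\mid\ell^{-1}(n)+(k-1)<m\leq\ell^{-1}(n)+k\}$. For a horizontal line $\ell$: $\mathrm{lnb}_k(\ell)=\{(m,n)\in\mathbb{N}^2\mid\ell(m)+(k-1)<n\leq\ell(m)+k\}$. *)

(* Defs.v *)
(* MathComp world, with the classical sets and real numbers of MathComp-Analysis. *)
From HB Require Import structures.
From mathcomp Require Import all_boot all_order all_algebra.
From mathcomp Require Import boolp classical_sets functions cardinality.
From mathcomp Require Import reals constructive_ereal.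

Set Implicit Arguments.
Unset Strict Implicit.
Unset Printing Implicit Defensive.

Import Order.TTheory GRing.Theory Num.Theory.

Local Open Scope classical_set_scope.
Local Open Scope ring_scope.

(* Greatest and least element of a set; the default value x0 is returned when
   there is none. *)
Definition maximum {d : Order.disp_t} {T : porderType d} (x0 : T) (S : set T) : T :=
  xget x0 [set x | S x /\ ubound S x].

Definition minimum {d : Order.disp_t} {T : porderType d} (x0 : T) (S : set T) : T :=
  xget x0 [set x | S x /\ lbound S x].

Record ocn : Type := OCN {
  states : finType;
  actions : finType;
  rules : states -> actions -> int -> states -> bool;
  rules_effect : forall p a d q, rules p a d q -> d \in [:: -1; 0; 1] }.

Definition config (N : ocn) : Type := (states N * nat)%type.

Definition trans (N : ocn) (s : config N) (a : actions N) (t : config N) : Prop :=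
  rules s.1 a (t.2%:Z - s.2%:Z) t.1.

Definition simulation (N : ocn) (S : config N -> config N -> Prop) : Prop :=
  forall s t, S s t -> forall a s', trans s a s' ->
    exists2 t', trans t a t' & S s' t'.

Definition simulated (N : ocn) (s t : config N) : Prop :=
  exists2 S : config N -> config N -> Prop, simulation S & S s t.

Definition plane (N : ocn) : finType := (states N * states N)%type.

Definition black (N : ocn) (P : plane N) (mn : nat * nat) : Prop :=
  simulated (P.1, mn.1) (P.2, mn.2).

Definition white (N : ocn) (P : plane N) (mn : nat * nat) : Prop :=
  ~ black P mn.

Definition frontier (N : ocn) (P : plane N) (n : nat) : \bar int :=
  if `[< forall m, black P (m, n) >] then +oo%E
  else if `[< ~ black P (0%N, n) >] then (-1)%:E
  else ((maximum 0%N [set m | black P (m, n)])%:Z)%:E.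

Definition HF (N : ocn) : set (plane N) :=
  [set P | exists n, frontier P n = +oo%E].

Definition VF (N : ocn) : set (plane N) :=
  [set P | ~ HF P /\ exists c : int, forall n, (frontier P n <= c%:E)%E].

Definition SF (N : ocn) : set (plane N) :=
  [set P | ~ HF P /\ ~ VF P].

Arguments HF : clear implicits.
Arguments VF : clear implicits.
Arguments SF : clear implicits.

(* Graph a c is the line y = a x + c (horizontal if a = 0), Vertical c the
   line x = c. *)
Inductive line (R : realType) : Type :=
| Graph of R & R
| Vertical of R.

Definition line_points (R : realType) (l : line R) : set (R * R) :=
  match l with
  | Graph a c => [set v | v.2 = a * v.1 + c]
  | Vertical c => [set v | v.1 = c]
  end.

(* Meaningless on horizontal lines, where it is not used. *)
Definition line_inv (R : realType) (l : line R) (y : R) : R :=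
  match l with
  | Graph a c => (y - c) / a
  | Vertical c => c
  end.

Definition eucl (R : realType) (u v : R * R) : R :=
  Num.sqrt ((u.1 - v.1) ^+ 2 + (u.2 - v.2) ^+ 2).

Definition dist (R : realType) (u : R * R) (l : line R) : R :=
  let d := inf [set eucl u v | v in line_points l] in
  if u.1 < line_inv l u.2 then - d else d.

(* Only used for planes whose frontier function is finite. *)
Definition frontier_point (R : realType) (N : ocn) (P : plane N) (n : nat) : R * R :=
  ((fine (frontier P n))%:~R, n%:R).

(* For P in SF there is exactly one such slope. *)
Definition is_slope (R : realType) (N : ocn) (P : plane N) (a : rat) : Prop :=
  0 < a /\
  exists b : R, forall n, `|dist (frontier_point R P n) (Graph (ratr a) 0)| <= b.

Definition alpha (R : realType) (N : ocn) (P : plane N) : \bar rat :=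
  if `[< HF N P >] then 0%:E
  else if `[< VF N P >] then +oo%E
  else (xget 0 [set a | is_slope R P a])%:E.

Definition ell (R : realType) (N : ocn) (P : plane N) : line R :=
  if alpha R P is a%:E then Graph (ratr a) 0 else Vertical 0.

Definition recurrent_dists (R : realType) (N : ocn) (P : plane N) : set R :=
  [set r | infinite_set [set n | r = dist (frontier_point R P n) (ell R P)]].

Arguments recurrent_dists R {N} P.

Definition HF_dist (R : realType) (N : ocn) (P : plane N) : R :=
  - (minimum 0%N [set n | frontier P n = +oo%E])%:R.

Definition mind (R : realType) (N : ocn) (P : plane N) : R :=
  if `[< HF N P >] then HF_dist R P else minimum 0 (recurrent_dists R P).

Definition maxd (R : realType) (N : ocn) (P : plane N) : R :=
  if `[< HF N P >] then HF_dist R P else maximum 0 (recurrent_dists R P).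

Definition spand (R : realType) (N : ocn) (P : plane N) : R :=
  maxd R P - mind R P.

Definition leL (R : realType) (N : ocn) : rel (plane N) := fun P P' =>
  (alpha R P' < alpha R P)%E
  || ((alpha R P == alpha R P') && (mind R P <= mind R P')).

Definition leR (R : realType) (N : ocn) : rel (plane N) := fun P P' =>
  (alpha R P < alpha R P')%E
  || ((alpha R P == alpha R P') && (maxd R P' <= maxd R P)).

Definition eqvL (R : realType) (N : ocn) : rel (plane N) := fun P P' =>
  leL R P P' && leL R P' P.

Definition eqvR (R : realType) (N : ocn) : rel (plane N) := fun P P' =>
  leR R P P' && leR R P' P.

(* Number of classes of the equivalence e represented among the first i
   entries of s. *)
Definition nclasses (T : finType) (e : rel T) (s : seq T) (i : nat) : nat :=
  #|equivalence_partition e (finset (mem (take i s)))|.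

Definition planes_of_slope (R : realType) (N : ocn) (a : \bar rat) : {set plane N} :=
  finset (fun P : plane N => alpha R P == a).

Definition planes_ms (R : realType) (N : ocn) (a : \bar rat) : {set plane N} :=
  finset (fun P : plane N => (P \in planes_of_slope R N a) &&
    [forall P' in planes_of_slope R N a, spand R P' <= spand R P]).

Definition step (R : realType) (a : R) : R := 1 + 1 / a.

(* Only used for lines of positive slope and vertical lines. *)
Definition rnb (R : realType) (k : nat) (l : line R) : set (nat * nat) :=
  let w := if l is Graph a _ then step a else 1 in
  [set p | line_inv l p.2%:R + (k%:R - 1) * w < p.1%:R
             <= line_inv l p.2%:R + k%:R * w].

(* Only used for lines of positive slope and horizontal lines. On a horizontal
   line (first case) the neighbourhood is measured vertically. *)
Definition lnb (R : realType) (k : nat) (l : line R) : set (nat * nat) :=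
  match l with
  | Graph a c =>
      if a == 0 then [set p | c + (k%:R - 1) < p.2%:R <= c + k%:R]
      else [set p | line_inv l p.2%:R - k%:R * step a <= p.1%:R
                      < line_inv l p.2%:R - (k%:R - 1) * step a]
  | Vertical c => [set p | c - k%:R <= p.1%:R < c - (k%:R - 1)]
  end.

(* Main.v *)
(* Spoiler's and Duplicator's play on integer points (m, n) of the planes is governed by
   the linear functional [m - l n] attached to a line of inverse slope [l]. Suppose every
   plane P of slope [l] carries a potential that a move of Duplicator from P can follow;
   then Duplicator survives from all points sufficiently far to the left of the line,
   where "sufficiently" is counted by the number of planes (or classes) of larger
   potential, since overshooting the current potential costs at most one step 1 + l.
   Dually, Spoiler wins to the right of the line by copying a winning play from a far
   point of the frontier. Potentials are read off from extremal frontier points. This is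
   used twice: first with approximate potentials, to show that each frontier stays within
   bounded distance of a line, and then with the exact recurrent extrema of the frontier,
   which yields (2) and (3). For (1), two tokens at constant distance, a black and a white
   one in a plane of maximal span, are forced to stay in planes of maximal span, so that
   a plane is repeated at a different point of the same line. For (4), the finitely many
   integers describing the frontiers of HF (resp. VF) planes inside the belt around the
   axis have no gap above a polynomial bound, because beyond a gap a winning strategy
   would still win after a shift by one. *)
Require Import Defs.
From HB Require Import structures.
From mathcomp Require Import all_boot all_order all_algebra.
From mathcomp Require Import boolp classical_sets functions cardinality.
From mathcomp Require Import reals constructive_ereal.
From mathcomp Require Import zify ring lra.
Import Order.TTheory GRing.Theory Num.Theory.
Local Open Scope classical_set_scope.
Local Open Scope ring_scope.

Set Implicit Arguments.
Unset Strict Implicit.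
Unset Printing Implicit Defensive.

(** * The simulation game on integer points *)

(** If every [t] fails from some stage on, all fail at the maximum of these stages. This turns a
    choice depending on [j] into a single one, both for Duplicator's replies and for rankings of
    planes. *)
Lemma finite_pigeonhole (T : finType) (D : T -> nat -> Prop) :
  (forall t i j, (i <= j)%N -> D t j -> D t i) ->
  (forall j, exists t, D t j) -> exists t, forall j, D t j.
Proof.
move=> anti ex; apply: contrapT => nex.
have [f fP] : {f : T -> nat & forall t, ~ D t (f t)}.
  apply: (choice (P := fun t j => ~ D t j)) => t.
  by apply: contrapT => h; apply: nex; exists t => j; apply: contrapT => hj; apply: h; exists j.
have [t tP] := ex (\max_t f t)%N.
by apply: (fP t); apply: anti tP; apply: leq_bigmax.
Qed.

Lemma finite_bound (T : finType) (R : realType) (Q : T -> R -> Prop) :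
  (forall t, exists c, forall c', c <= c' -> Q t c') ->
  exists c, forall t c', c <= c' -> Q t c'.
Proof.
move=> /choice[f fP]; exists (\sum_t `|f t|) => t c' h; apply: fP.
apply: le_trans h; rewrite (bigD1 t) //= (le_trans (ler_norm _)) // lerDl.
by apply: sumr_ge0.
Qed.

Section Game.
Variable N : ocn.
Implicit Types (P : plane N) (m n d : int).

(* A point with n < 0 is lost for Duplicator, so his moves need no side condition. *)
Fixpoint survives k P m n : Prop :=
  0 <= n /\
  if k is k'.+1 then
    forall a d p', rules P.1 a d p' -> 0 <= m + d ->
      exists d' q', rules P.2 a d' q' /\ survives k' (p', q') (m + d) (n + d')
  else True.

(** Finite-round approximations replace the coinductive notion: Duplicator has finitely many
    replies, so nothing is lost ([blackz_step]), and every white point gets a finite rank for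
    inductions on Spoiler's play. *)
Definition blackz P m n := forall k, survives k P m n.

Lemma survivesW k P m n : survives k.+1 P m n -> survives k P m n.
Proof.
elim: k P m n => [|k IH] P m n [n0 h]; first by [].
split=> // a d p' r md; have [d' [q' [r' s]]] := h _ _ _ r md.
by exists d', q'; split=> //; apply: IH.
Qed.

Lemma survives_anti i j P m n : (i <= j)%N -> survives j P m n -> survives i P m n.
Proof.
move=> /subnK <-; elim: (j - i)%N => // k IH h.
by apply: IH; apply: survivesW.
Qed.

Lemma survives_mono k P m n m' n' : m' <= m -> n <= n' ->
  survives k P m n -> survives k P m' n'.
Proof.
elim: k P m n m' n' => [|k IH] P m n m' n' hm hn [n0 h]; split=> //; try lia.
move=> a d p' r md; have [|d' [q' [r' s]]] := h _ _ _ r; first lia.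
by exists d', q'; split=> //; apply: IH s; lia.
Qed.

Lemma blackz_mono P m n m' n' : m' <= m -> n <= n' -> blackz P m n -> blackz P m' n'.
Proof. by move=> hm hn h k; apply: survives_mono (h k). Qed.

Lemma blackz_ge0 P m n : blackz P m n -> 0 <= n.
Proof. by move=> /(_ 0%N)[]. Qed.

Lemma effect_bound p a d q : @rules N p a d q -> -1 <= d <= 1.
Proof. by move=> /rules_effect; rewrite !inE => /or3P[] /eqP->. Qed.

Lemma effect_ord p a d q : @rules N p a d q -> exists i : 'I_3, d = i%:Z - 1.
Proof.
move=> /rules_effect; rewrite !inE => /or3P[] /eqP->.
- by exists (@Ordinal 3 0 isT).
- by exists (@Ordinal 3 1 isT).
- by exists (@Ordinal 3 2 isT).
Qed.

(** Effects live in the infinite type [int]; coding them in ['I_3] makes the replies a finite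
    type. *)
Lemma reply_pigeonhole q (a : actions N) (D : int -> states N -> nat -> Prop) :
  (forall d' q' i j, (i <= j)%N -> D d' q' j -> D d' q' i) ->
  (forall j, exists d' q', @rules N q a d' q' /\ D d' q' j) ->
  exists d' q', @rules N q a d' q' /\ forall j, D d' q' j.
Proof.
move=> anti ex.
have [|j|[i q'] h] := @finite_pigeonhole ('I_3 * states N)%type
  (fun t j => @rules N q a (t.1%:Z - 1) t.2 /\ D (t.1%:Z - 1) t.2 j).
- by move=> t i j ij [r h]; split=> //; apply: anti h.
- have [d' [q' [r h]]] := ex j.
  by have [i di] := effect_ord r; exists (i, q'); rewrite -di.
by exists (i%:Z - 1), q'; split=> [|j]; [have [] := h 0%N | have [] := h j].
Qed.

Lemma blackz_step P m n : blackz P m n ->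
  forall a d p', rules P.1 a d p' -> 0 <= m + d ->
    exists d' q', rules P.2 a d' q' /\ blackz (p', q') (m + d) (n + d').
Proof.
move=> h a d p' r md; apply: reply_pigeonhole => [d' q' i j|j].
  exact: survives_anti.
by have [_ /(_ _ _ _ r md)] := h j.+1.
Qed.

Lemma not_survives_step k P m n : 0 <= n -> ~ survives k.+1 P m n ->
  exists a d p', [/\ rules P.1 a d p', 0 <= m + d &
    forall d' q', rules P.2 a d' q' -> ~ survives k (p', q') (m + d) (n + d')].
Proof.
move=> n0 h; apply: contrapT => nex; apply: h; split=> // a d p' r md.
apply: contrapT => h; apply: nex; exists a, d, p'; split=> // d' q' r' s.
by apply: h; exists d', q'.
Qed.

Lemma whiteP P m n : ~ blackz P m n -> exists k, ~ survives k P m n.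
Proof. by move=> h; apply: contrapT => g; apply: h => k; apply: contrapT => nk; apply: g; exists k. Qed.

Lemma not_survives_white k P m n : ~ survives k P m n -> ~ blackz P m n.
Proof. by move=> h /(_ k). Qed.

Lemma black_coind (S : plane N -> int -> int -> Prop) :
  (forall P m n, S P m n -> 0 <= n /\
    forall a d p', rules P.1 a d p' -> 0 <= m + d ->
    exists d' q', rules P.2 a d' q' /\ S (p', q') (m + d) (n + d')) ->
  forall P m n, S P m n -> blackz P m n.
Proof.
move=> H P m n s k; elim: k P m n s => [|k IH] P m n /H[n0 h]; split=> //.
move=> a d p' r md; have [d' [q' [r' s]]] := h _ _ _ r md.
by exists d', q'; split=> //; apply: IH.
Qed.

(** A simulation is closed under Duplicator's replies, hence contained in [blackz] by [black_coind];
    conversely [blackz] is itself a simulation. *)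
Lemma blackE P (x : nat * nat) : black P x <-> blackz P x.1 x.2.
Proof.
split=> [[S simS]|h].
  rewrite -[(P.1, x.1)]/(P.1, `|x.1%:Z|%N) -[(P.2, x.2)]/(P.2, `|x.2%:Z|%N).
  have : 0 <= x.2%:Z by []. have : 0 <= x.1%:Z by [].
  move: (x.1%:Z) (x.2%:Z) => m n m0 n0 s.
  pose S' P m n := [/\ 0 <= m, 0 <= n & S (P.1, `|m|%N) (P.2, `|n|%N)].
  apply: (@black_coind S') => // {m n s m0 n0} {}P m n [m0 n0 s]; split=> // a d p' r md.
  have [|[q' n'] t S''] := simS _ _ s a (p', absz (m + d)).
    by rewrite /trans /=; have -> : (absz (m + d))%:Z - `|m|%N%:Z = d by lia.
  exists (n'%:Z - n), q'; split.
    by move: t; rewrite /trans /=; have -> : n'%:Z - `|n|%N%:Z = n'%:Z - n by lia.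
  by rewrite /S' /=; split=> //; [lia | have -> : n + (n'%:Z - n) = n' by lia].
exists (fun s t : config N => blackz (s.1, t.1) s.2%:Z t.2%:Z); last by case: P h.
move=> [p m] [q n] /= /blackz_step H a [p' m'] t.
have [/=||d' [q' [r' b]]] := H a (m'%:Z - m%:Z) p'; [exact: t | lia |].
have n0 := blackz_ge0 b.
exists (q', absz (n%:Z + d')); rewrite /trans /=.
  by have -> : (absz (n%:Z + d'))%:Z - n%:Z = d' by lia.
move: b; have -> : m%:Z + (m'%:Z - m%:Z) = m' by lia.
by have -> : (absz (n%:Z + d'))%:Z = n%:Z + d' by lia.
Qed.

End Game.

(** * Certificates for black and white regions *)

Section Certificates.
Variables (R : realType) (N : ocn).
Implicit Types (P Q : plane N) (m n d : int) (a b eta : R).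

(** With [a = 1] and [b = l] this is the horizontal displacement from the line of inverse slope [l];
    with [a = 0] and [b = 1] it is minus the height and serves [HF] planes. One move changes it by
    at most [a + b]. *)
Definition offset a b m n : R := a * m%:~R - b * n%:~R.

Lemma offsetD a b m n d d' :
  offset a b (m + d) (n + d') = offset a b m n + offset a b d d'.
Proof. rewrite /offset !rmorphD /=; ring. Qed.

Lemma ler_effect d : -1 <= d <= 1 -> (-1 <= d%:~R :> R) && (d%:~R <= 1 :> R).
Proof. by move=> /andP[]; rewrite -!(ler_int R) mulrN1z mulr1z => -> ->. Qed.

Lemma offset_effect a b d d' : 0 <= a -> 0 <= b -> -1 <= d <= 1 -> -1 <= d' <= 1 ->
  - (a + b) <= offset a b d d' <= a + b.
Proof.
move=> a0 b0 hd hd'; rewrite /offset.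
have /andP[h1 h2] := ler_effect hd; have /andP[h3 h4] := ler_effect hd'.
apply/andP; split; nra.
Qed.

Lemma offset_lt0 a b m n : 0 <= a -> 0 <= b -> 0 <= m -> offset a b m n < 0 -> 0 < n.
Proof.
move=> a0 b0 m0; rewrite /offset -(ler0z R) in m0 *; rewrite ltNge => /negP h.
rewrite ltNge; apply/negP => n0; apply: h; rewrite -(lerz0 R) in n0; nra.
Qed.

Lemma offset_gt0 a b m n : 0 <= a -> 0 <= b -> 0 <= n -> 0 < offset a b m n -> 0 < m.
Proof.
move=> a0 b0 m0; rewrite /offset -(ler0z R) in m0 *; rewrite ltNge => /negP h.
rewrite ltNge; apply/negP => n0; apply: h; rewrite -(lerz0 R) in n0; nra.
Qed.

(* A play is followed relative to a base plane P0 whose potential bounds that of the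
   current plane P; a plane of larger potential becomes the new base, which costs one
   unit of cnt. *)
Lemma black_certificate a b eta (C : plane N -> Prop) (phi cnt : plane N -> R) :
  0 <= a -> 0 <= b -> 0 <= eta -> (forall P, C P -> 0 <= cnt P) ->
  (forall P Q, C P -> C Q -> phi P < phi Q -> cnt Q <= cnt P - 1) ->
  (forall P c d p', C P -> rules P.1 c d p' -> exists d' q', rules P.2 c d' q' /\
     let Q := (p', q') in
     (C Q /\ phi P + offset a b d d' - eta <= phi Q) \/
     (~ C Q /\ forall P0 m n, C P0 -> 0 <= m -> 0 <= n ->
        offset a b m n < - ((cnt P0 - 1) * (a + b)) -> blackz Q m n)) ->
  forall k P m n, C P -> 0 <= m -> offset a b m n < - (cnt P * (a + b)) - k%:R * eta ->
    survives k P m n.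
Proof.
move=> a0 b0 eta0 cnt0 ord edge k P m n CP m0 hx.
(* [P0] is the base plane, and [k%:R * eta] reserves the error of the remaining rounds. *)
have : exists P0, [/\ C P0, phi P <= phi P0 &
  offset a b m n + k%:R * eta - phi P < - phi P0 - cnt P0 * (a + b)].
  by exists P; split=> //; lra.
elim: k P m n CP m0 {hx} => [|k IH] P m n CP m0 [P0 [CP0 le0 hx]].
  split=> //; apply: ltW; apply: (offset_lt0 a0 b0 m0).
  have := mulr_ge0 (cnt0 _ CP0) (addr_ge0 a0 b0); lra.
have cs := mulr_ge0 (cnt0 _ CP0) (addr_ge0 a0 b0).
have ke : 0 <= k%:R * eta by rewrite mulr_ge0.
rewrite -natr1 mulrDl mul1r in hx.
have n0 : 0 < n by apply: (offset_lt0 a0 b0 m0); lra.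
split=> [|c d p' r md]; first exact: ltW.
have [d' [q' [r' h]]] := edge _ _ _ _ CP r.
have bd := effect_bound r; have bd' := effect_bound r'.
have /andP[v1 v2] := offset_effect a0 b0 bd bd'.
exists d', q'; split=> //.
have nd : 0 <= n + d' by clear -n0 bd'; lia.
have hx' := offsetD a b m n d d'.
case: h => [[CQ ph]|[_ h]].
  apply: IH => //; case: (lerP (phi (p', q')) (phi P0)) => [le1|lt1].
    by exists P0; split=> //; lra.
  (* As [phi P <= phi P0], the offset was already below [- cnt P0 * (a + b)]; the move raises it by
     at most [a + b], which the drop of [cnt] compensates. *)
  exists (p', q'); split=> //; have := ord _ _ CP0 CQ lt1.
  have s0 := addr_ge0 a0 b0 => h.
  have : cnt (p', q') * (a + b) <= (cnt P0 - 1) * (a + b) by apply: ler_wpM2r.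
  rewrite mulrBl mul1r; lra.
apply: (h P0) => //; rewrite mulrBl mul1r; lra.
Qed.

(* Spoiler at (m, n) copies a winning play from a white point y far above on the same
   line. When the play reaches a plane of smaller cnt, a new far point is chosen. *)
Lemma white_certificate a b (C S : plane N -> Prop) (cnt : plane N -> R) :
  0 <= a -> 0 <= b -> (forall P, C P -> 0 <= cnt P) ->
  (forall P P0 m n, S P -> C P0 -> 0 <= m -> 0 <= n ->
     (cnt P0 - 1) * (a + b) < offset a b m n -> ~ blackz P m n) ->
  (forall j : nat, exists (psi : plane N -> R) (n0 : nat),
    [/\ forall P, C P -> exists m n, [/\ ~ blackz P m n, 0 <= m, n0%:Z + j%:Z <= n &
          offset a b m n <= psi P + (j.+1%:R)^-1],
        forall P P0 m n, C P0 -> ~ S P -> 0 <= m -> n0%:Z <= n -> ~ blackz P m n ->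
          C P /\ psi P <= offset a b m n \/ ~ C P /\ psi P0 <= offset a b m n
      & forall P Q, C P -> C Q -> psi Q < psi P -> cnt Q <= cnt P - 1]) ->
  forall P m n, C P -> 0 <= m -> cnt P * (a + b) < offset a b m n -> ~ blackz P m n.
Proof.
move=> a0 b0 cnt0 hS data P; have s0 := addr_ge0 a0 b0.
have [t] := ubnP #|[pred Q | `[< C Q >] && (cnt Q < cnt P)]|.
elim: t P => // t IH P0 tP m0 n0 CP0 m00 hx0.
have c0 := mulr_ge0 (cnt0 _ CP0) s0.
have [n00|n00] := ltP n0 0; first by move=> /blackz_ge0; lia.
(* The winning play from the far point [(A, D)] is translated to [(m0, n0)]. The error
   [(j.+1%:R)^-1] must be below [gap] for the near copy to stay beyond its threshold, and [j] must
   reach [n0] for the far copy to stay above row [nn]. *)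
pose gap := offset a b m0 n0 - cnt P0 * (a + b).
have gap0 : 0 < gap by rewrite /gap; lra.
pose j := maxn (Num.bound gap^-1) `|n0|%N.
have [psi [nn [far wh ord]]] := data j.
have [A [D [wy A0 Dn hy]]] := far _ CP0.
have jgap : (j.+1%:R)^-1 < gap.
  rewrite -[X in _ < X]invrK ltf_pV2 ?posrE ?invr_gt0 ?ltr0n //.
  apply: lt_le_trans (archi_boundP _) _; first by rewrite invr_ge0 ltW.
  by rewrite ler_nat ltnW // ltnS leq_maxl.
have jn0 : n0 <= j%:Z by rewrite /j; clear -n00; lia.
have [k wk] := whiteP wy.
suff main k' P m n : ~ survives k' P (m + (A - m0)) (n + (D - n0)) ->
    0 <= m -> 0 <= m + (A - m0) -> ~ S P -> (C P -> psi P0 <= psi P) -> ~ blackz P m n.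
  have [SP0|nSP0] := pselect (S P0).
    apply: (hS _ _ _ _ SP0 CP0 m00 n00); rewrite mulrBl mul1r; lra.
  have eA : m0 + (A - m0) = A by clear; lia.
  have eD : n0 + (D - n0) = D by clear; lia.
  by apply: (main k P0); rewrite ?eA ?eD.
elim: k' P m n => [|k' IHk] P m n wf m1 m2 nSP psiP.
  by move=> /blackz_ge0 n1; apply: wf; split=> //; clear -n1 Dn jn0; lia.
move=> B; have n1 := blackz_ge0 B.
have n2 : nn%:Z <= n + (D - n0) by clear -n1 Dn jn0; lia.
(* Whiteness of the far copy bounds its offset from below; this carries over to the near copy and
   yields [0 < m], so that Spoiler's move is legal there too. *)
have pf : psi P0 <= offset a b (m + (A - m0)) (n + (D - n0)).
  case: (wh P P0 _ _ CP0 nSP m2 n2 (not_survives_white wf)) => [[CP h]|[_ //]].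
  by apply: le_trans h; apply: psiP.
have hx : cnt P0 * (a + b) < offset a b m n.
  move: pf; rewrite /gap /offset in jgap hy hx0 *; rewrite !rmorphD !rmorphN /= => pf.
  by move: (_^-1) jgap hy => inv jgap hy; lra.
have mpos : 0 < m by apply: (offset_gt0 a0 b0 n1); lra.
have [|c [d [p' [r md h]]]] := not_survives_step _ wf; first by clear -n2; lia.
have bd := effect_bound r.
have [|d' [q' [r' B']]] := blackz_step B r; first by clear -mpos bd; lia.
have bd' := effect_bound r'.
have /andP[v1 v2] := offset_effect a0 b0 bd bd'.
have hx' := offsetD a b m n d d'.
have n3 := blackz_ge0 B'; have m3 : 0 <= m + d by clear -mpos bd; lia.
pose Q := (p', q').
have hx2 : (cnt P0 - 1) * (a + b) < offset a b (m + d) (n + d'). by rewrite mulrBl mul1r; lra.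
have [SQ|nSQ] := pselect (S Q); first exact: (hS _ _ _ _ SQ CP0 m3 n3 hx2 B').
have wQ : ~ survives k' Q (m + d + (A - m0)) (n + d' + (D - n0)).
  have := h _ _ r'; have -> : m + (A - m0) + d = m + d + (A - m0) by clear -md; lia.
  by have -> : n + (D - n0) + d' = n + d' + (D - n0) by clear; lia.
have m4 : 0 <= m + d + (A - m0) by clear -md; lia.
have [CQ|nCQ] := pselect (C Q); last by apply: (IHk Q _ _ wQ m3 m4 nSQ _ B') => /nCQ.
have [le0|lt0] := lerP (psi P0) (psi Q); first exact: (IHk Q _ _ wQ m3 m4 nSQ _ B').
have cQ := ord _ _ CP0 CQ lt0.
(* In a plane of smaller potential [cnt] has dropped by at least one, which pays for the change of
   offset; a new far point is then taken for [Q]. *)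
apply: (IH Q _ _ _ CQ m3 _ B').
  rewrite ltnS in tP; apply: leq_trans tP; apply: proper_card; apply/properP; split.
    apply/fintype.subsetP => q; rewrite !inE => /andP[-> /=] h'; lra.
  exists Q; rewrite !inE ?ltxx ?andbF //; apply/andP; split; first exact/asboolP.
  lra.
apply: le_lt_trans hx2; exact: ler_wpM2r.
Qed.
End Certificates.

(** * Frontiers *)

Lemma nat_set_max (S : set nat) w : S !=set0 -> (forall i, S i -> (i <= w)%N) ->
  exists i, S i /\ forall j, S j -> (j <= i)%N.
Proof.
move=> [i0 Si0] hw.
have ex : exists i, `[< S i >] by exists i0; apply/asboolP.
have bd i : `[< S i >] -> (i <= w)%N by move=> /asboolP /hw.
have [i /asboolP Si maxi] := ex_maxnP ex bd.
by exists i; split=> // j Sj; apply/maxi/asboolP.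
Qed.

Section Frontier.
Variable N : ocn.
Implicit Types (P Q : plane N) (m d : int) (n : nat).

(** [fine] sends [+oo] to [0], so the value is meaningful only where the frontier is finite, in
    particular outside [HF]. *)
Definition fr P n : int := fine (frontier P n).

Lemma frontier_infty P n : frontier P n = +oo%E <-> forall m, blackz P m n%:Z.
Proof.
rewrite /frontier; case: asboolP => [all|nall].
  split=> // _ m; apply: (@blackz_mono _ _ `|m|%N%:Z n%:Z); [lia|by []|].
  exact/(blackE P (_, _))/all.
split; first by case: ifP.
by move=> h; case: nall => m; apply/(blackE P (_, _)).
Qed.

Lemma frP P n : frontier P n <> +oo%E ->
  [/\ frontier P n = (fr P n)%:E, -1 <= fr P n &
      forall m, 0 <= m -> (blackz P m n%:Z <-> m <= fr P n)].
Proof.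
rewrite /fr /frontier; case: asboolP => [//|nall]; case: asboolP => [w|b] _ /=.
  split=> // m m0; split=> [h|]; last by lia.
  by case: w; apply/(blackE P (_, _)); apply: blackz_mono h.
set S := [set m | black P (m, n)].
have [w wP] : exists w, ~ black P (w, n).
  by apply: contrapT => h; apply: nall => m; apply: contrapT => h'; apply: h; exists m.
have lew i : S i -> (i <= w)%N.
  rewrite leqNgt => Si; apply/negP => wi; apply: wP; apply/(blackE P (_, _)).
  by apply: blackz_mono (proj1 (blackE P (i, n)) Si) => //=; lia.
have [||i [Si maxi]] := @nat_set_max S w; [by exists 0%N; apply: contrapT | by [] |].
have : (S `&` ubound S) (maximum 0%N S).
  by apply: (xgetPex 0%N); exists i; split=> // j Sj; apply: maxi.
move: (maximum _ _) => {maxi Si}i [Si maxi]; split=> //= m m0; split=> [h|mi].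
  have : S `|m|%N by apply/(blackE P (_, _)); have -> : (absz m)%:Z = m by lia.
  by move=> /maxi; rewrite leEnat; lia.
by apply: blackz_mono (proj1 (blackE P (i, n)) Si).
Qed.

Lemma not_HFP P : ~ HF N P -> forall n, frontier P n <> +oo%E.
Proof. by move=> h n e; apply: h; exists n. Qed.

Lemma fr_ge P n : ~ HF N P -> -1 <= fr P n.
Proof. by move=> /not_HFP /(_ n) /frP[]. Qed.

Lemma blackz_fr P m n : ~ HF N P -> 0 <= m -> (blackz P m n%:Z <-> m <= fr P n).
Proof. by move=> /not_HFP /(_ n) /frP[_ _ h] m0; apply: h. Qed.

Lemma blackz_fr_le P m (n : int) : ~ HF N P -> 0 <= m -> 0 <= n -> blackz P m n -> m <= fr P `|n|%N.
Proof. by move=> nh m0 n0 b; apply/(blackz_fr _ nh m0); have -> : (absz n)%:Z = n by lia. Qed.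

Lemma white_gt_fr P m (n : int) : ~ HF N P -> 0 <= m -> 0 <= n -> ~ blackz P m n -> fr P `|n|%N + 1 <= m.
Proof.
move=> nh m0 n0 b; rewrite leNgt; apply/negP => h; apply: b.
have -> : n = (absz n)%:Z by lia.
by apply/(blackz_fr _ nh m0); lia.
Qed.

Lemma gt_fr_white P m (n : int) : ~ HF N P -> 0 <= m -> 0 <= n -> fr P `|n|%N < m -> ~ blackz P m n.
Proof. by move=> nh m0 n0 h /(blackz_fr_le nh m0 n0); lia. Qed.

Lemma fr_mono P n n' : ~ HF N P -> (n <= n')%N -> fr P n <= fr P n'.
Proof.
move=> nh le; have h := fr_ge n nh; have h' := fr_ge n' nh.
have [->//|h1] : fr P n = -1 \/ 0 <= fr P n by lia.
apply/(blackz_fr _ nh h1); apply: blackz_mono (proj2 (blackz_fr n nh h1) (lexx _)) => //.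
Qed.

Lemma HF_height : exists K : nat, forall P, HF N P -> forall m (n : int), K%:Z <= n -> blackz P m n.
Proof.
have /choice[f fP] : forall P : plane N, exists n : nat, HF N P -> forall m, blackz P m n.
  move=> P; have [[n /frontier_infty h]|nh] := pselect (HF N P); first by exists n.
  by exists 0%N.
exists (\max_P f P)%N => P hP m n le; apply: blackz_mono (fP P hP m) => //.
have : (f P <= \max_P f P)%N by apply: leq_bigmax.
lia.
Qed.

(** Spoiler repeats the winning play one row higher and [R0] columns to the right. If it comes down
    to row [K], the translated token is on row [K + 1], where [R0] exceeds every finite frontier
    value. *)
Lemma white_translate : exists K R0 : nat, forall P m (n : int), 0 <= m -> K%:Z <= n ->
  ~ blackz P m n -> ~ blackz P (m + R0%:Z) (n + 1).
Proof.
have [K KP] := HF_height.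
pose R0 := (\max_P `|fr P K.+1|).+1%N; exists K, R0 => P m n m0 Kn /whiteP[k].
elim: k P m n m0 Kn => [|k IH] P m n m0 Kn wk; first by case: wk; split=> //; lia.
have [Kn'|n0] : n = K%:Z \/ K%:Z < n by lia.
  have nh : ~ HF N P by move=> /KP h; apply: (not_survives_white wk); apply: h.
  apply: gt_fr_white => //; [lia|lia|].
  have -> : absz (n + 1) = K.+1 by lia.
  have : (`|fr P K.+1|%N <= \max_P `|fr P K.+1|%N)%N by apply: leq_bigmax.
  rewrite /R0; lia.
have [|c [d [p' [r md h]]]] := not_survives_step _ wk; first by lia.
move=> B; have [|d' [q' [r' B']]] := blackz_step B r; first by lia.
have bd := effect_bound r'.
apply: (IH _ _ _ md _ (h _ _ r')); first by lia.
have -> : m + d + R0 = m + R0 + d by lia.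
by have -> : n + d' + 1 = n + 1 + d' by lia.
Qed.

End Frontier.

(** * Asymptotic slopes *)

Lemma finite_small (T : finType) (R : realType) (Q : T -> R -> Prop) :
  (forall t, exists2 e, 0 < e & forall e', 0 < e' -> e' <= e -> Q t e') ->
  exists2 e, 0 < e & forall t e', 0 < e' -> e' <= e -> Q t e'.
Proof.
move=> h.
have [|c cP] := @finite_bound T R (fun t x => 0 < x -> Q t x^-1).
  move=> t; have [e e0 eP] := h t; exists e^-1 => c' le c0; apply: eP; rewrite ?invr_gt0 //.
  by rewrite -[e]invrK lef_pV2 ?posrE ?invr_gt0.
exists (Num.max c 1)^-1 => [|t e' e0 le]; first by rewrite invr_gt0 lt_max ltr01 orbT.
rewrite -[e']invrK; apply: cP; rewrite ?invr_gt0 //.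
have m0 : 0 < Num.max c 1 by rewrite lt_max ltr01 orbT.
apply: le_trans (_ : Num.max c 1 <= _); first by rewrite le_max lexx.
by rewrite -[X in X <= _]invrK lef_pV2 ?posrE ?invr_gt0.
Qed.

Section Sequences.
Variable R : realType.
Implicit Types (u g : nat -> R).

Lemma archi_lt (x y : R) : 0 < y -> exists j : nat, x < j%:R * y.
Proof.
move=> y0; exists (Num.bound (`|x| / y)); rewrite -ltr_pdivrMr //.
apply: le_lt_trans (archi_boundP _); last by rewrite divr_ge0 // ltW.
by rewrite ler_pM2r ?invr_gt0 // ler_norm.
Qed.

(** Otherwise every window of length [H] beyond [n0] would contribute at least [eta], a growth rate
    above [c]. This locates places where potentials of small linear drift are almost constant. *)
Lemma slow_growth g (H : nat) (eta c C : R) : c * H%:R < eta ->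
  (forall n, g n <= c * n%:R + C) -> forall n0, exists2 n, (n0 <= n)%N & g (n + H)%N - g n < eta.
Proof.
move=> lt gle n0; apply: contrapT => nex.
have up j : g n0 + j%:R * eta <= g (n0 + j * H)%N.
  elim: j => [|j IH]; first by rewrite mul0r addr0 mul0n addn0.
  rewrite leNgt; apply/negP => hlt; apply: nex; exists (n0 + j * H)%N; first exact: leq_addr.
  have -> : (n0 + j * H + H = n0 + j.+1 * H)%N by rewrite mulSn; lia.
  rewrite -natr1 mulrDl mul1r in hlt; lra.
have [j jP] := @archi_lt (c * n0%:R + C - g n0) (eta - c * H%:R) ltac:(lra).
have := le_trans (up j) (gle _); rewrite natrD natrM => h; nra.
Qed.

Fixpoint prefix_max u n : R :=
  if n is n'.+1 then Num.max (prefix_max u n') (u n) else u 0%N.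

Lemma prefix_max_ge u i n : (i <= n)%N -> u i <= prefix_max u n.
Proof.
elim: n => [|n IH]; first by rewrite leqn0 => /eqP->.
by rewrite leq_eqVlt ltnS => /orP[/eqP->|/IH h] /=; rewrite le_max ?lexx ?orbT ?h.
Qed.

Lemma prefix_max_attained u n : exists2 i, (i <= n)%N & prefix_max u n = u i.
Proof.
elim: n => [|n [i le e]] /=; first by exists 0%N.
by case: (leP (prefix_max u n)) => _; [exists n.+1 | exists i => //; apply: leqW].
Qed.

Lemma prefix_max_mono u n : prefix_max u n <= prefix_max u n.+1.
Proof. by rewrite /= le_max lexx. Qed.

End Sequences.

Section Slopes.
Variables (R : realType) (N : ocn).
Implicit Types (P Q : plane N) (m d : int) (n : nat) (t : R).

(** By [white_translate] the frontier gains at most [R0] per row above [K]. *)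
Lemma fr_linear P : ~ HF N P -> exists2 t, 0 <= t & exists C, forall n, (fr P n)%:~R <= t * n%:R + C :> R.
Proof.
move=> nh; have [K [R0 h]] := white_translate N.
exists R0%:R => //; exists (`|fr P K|%N%:R) => n.
have [le|lt] := leqP n K.
  have := fr_mono nh le => h1; rewrite -(ler_int R) in h1.
  apply: le_trans h1 _; apply: le_trans (_ : `|fr P K|%N%:R <= _).
    by rewrite -[X in _ <= X]/(`|fr P K|%N%:Z%:~R) ler_int; lia.
  by rewrite lerDr mulr_ge0.
rewrite -(subnK (ltnW lt)) addnC natrD mulrDr.
have : (fr P (K + (n - K))) <= `|fr P K|%N%:Z + R0%:Z * (n - K)%:Z.
  elim: (n - K)%N => [|j IH]; first by rewrite addn0; lia.
  have f0 := fr_ge (K + j)%N nh; have f1 := fr_ge (K + j).+1 nh.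
  have w : ~ blackz P (fr P (K + j)%N + 1) (K + j)%N by apply: gt_fr_white => //=; lia.
  have w' : ~ blackz P (fr P (K + j)%N + 1 + R0%:Z) (K + j).+1%N.
    have -> : (K + j).+1%N%:Z = (K + j)%N%:Z + 1 by lia.
    by apply: h w; lia.
  have := white_gt_fr nh _ _ w' => /(_ ltac:(lia) isT) /=; rewrite addnS; nia.
rewrite -(ler_int R) rmorphD rmorphM /= => h'; apply: le_trans h' _.
rewrite -!pmulrn addrC lerD2r lerDr mulr_ge0 //.
Qed.

(* The inverse of the paper's slope: 0 for the planes of VF, 1 / alpha_P for those of SF. *)
Definition lam P : R := inf [set t | 0 <= t /\ exists C, forall n, (fr P n)%:~R <= t * n%:R + C].

Lemma lam_ge0 P : ~ HF N P -> 0 <= lam P.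
Proof.
move=> nh; have [t t0 tP] := fr_linear nh.
by apply: lb_le_inf => [|x []]; first by exists t.
Qed.

Lemma lam_lt P t : ~ HF N P -> lam P < t -> exists C, forall n, (fr P n)%:~R <= t * n%:R + C.
Proof.
move=> nh /inf_lt[|x [x0 [C CP]] lt].
  by have [t' ? ?] := fr_linear nh; exists t'.
exists C => n; apply: le_trans (CP n) _; rewrite lerD2r ler_wpM2r // ltW //.
Qed.

Lemma lt_lam P t : ~ HF N P -> 0 <= t -> t < lam P -> forall C, exists n, t * n%:R + C < (fr P n)%:~R.
Proof.
move=> nh t0 lt C; apply: contrapT => h; have : lam P <= t.
  apply: ge_inf; [by exists 0 => x [] | split=> //].
  by exists C => n; rewrite leNgt; apply/negP => lt'; apply: h; exists n.
by rewrite leNgt lt.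
Qed.

Lemma lam_le P t : 0 <= t -> (exists C, forall n, (fr P n)%:~R <= t * n%:R + C) -> lam P <= t.
Proof. by move=> t0 h; apply: ge_inf; [exists 0 => x [] | split]. Qed.

End Slopes.

(** * Frontiers lie in linear belts *)

Section Belts.
Variables (R : realType) (N : ocn).
Implicit Types (P Q : plane N) (m d : int) (n : nat) (t : R).

Local Notation lam := (@lam R N).

Lemma offset1 t m d : offset 1 t m d = m%:~R - t * d%:~R.
Proof. by rewrite /offset mul1r. Qed.

(* With theta slightly below lam P, the prefix maxima of fr Q - theta n are potentials with
   small error at any n where they hardly grow; for planes steeper than theta they stay
   bounded, so that Duplicator cannot reply into such planes. *)
Lemma lower_belt_step P : ~ HF N P ->
  (forall Q, ~ HF N Q -> lam P < lam Q ->
     exists C, forall n, lam Q * n%:R - C <= (fr Q n)%:~R :> R) ->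
  exists C, forall n, lam P * n%:R - C <= (fr P n)%:~R :> R.
Proof.
move=> nhP flat; set l := lam P.
have l0 : 0 <= l := lam_ge0 R nhP.
have [l_eq|l_pos] : l = 0 \/ 0 < l by move: l0; rewrite le_eqVlt => /orP[/eqP|]; auto.
  exists 1 => n; rewrite l_eq mul0r sub0r -[- 1](rmorphN1 intr) ler_int.
  exact: fr_ge.
have [K KP] := HF_height N.
(* Replies may escape to [HF] planes and to planes of larger [lam]; these are already known to be
   black far enough to the left of the line. *)
have [T TP] : exists T : R, forall Q t, T <= t -> ~ (~ HF N Q /\ lam Q <= l) ->
    forall m (n : int), 0 <= m -> 0 <= n -> offset 1 l m n < - t -> blackz Q m n.
  apply: finite_bound => Q.
  have [hQ|nhQ] := pselect (HF N Q).
    exists (l * K%:R) => t le _ m n m0 n0; rewrite offset1 => h; apply: KP => //.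
    rewrite -(ler_int R); apply: ltW; rewrite -(ltr_pM2l l_pos).
    rewrite -(ler_int R) in m0; change (K%:~R : R) with (K%:R : R); lra.
  have [le|lt] := leP (lam Q) l; first by exists 0 => t _ [].
  have [C CP] := flat Q nhQ lt; exists C => t le _ m n m0 n0; rewrite offset1 => h.
  have n_abs : n = `|n|%N%:Z by lia.
  rewrite n_abs; apply/(blackz_fr _ nhQ m0); rewrite -(ler_int R).
  have := CP `|n|%N; have : (`|n|%N%:R : R) = n%:~R by rewrite {2}n_abs.
  move=> ->; rewrite -(ler_int R) in n0; nra.
pose T' := Num.max T 0; have T0 : 0 <= T' by rewrite le_max lexx orbT.
have {}TP Q := TP Q T' ltac:(by rewrite le_max lexx).
(* In [C0], one unit separates the frontier from its first white point, the other covers the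
   accumulated error of the play. *)
pose Kr : R := #|plane N|%:R; pose C0 := T' + Kr * (1 + l) + 2.
have Kr1 : 1 <= Kr by rewrite ler1n; apply/card_gt0P; exists P.
exists C0 => n; rewrite leNgt; apply/negP => lt.
have f_ge := fr_ge n nhP.
suff : blackz P (fr P n + 1) n.
  by move=> /(blackz_fr n nhP) h; clear -h f_ge; lia.
move=> k.
(* The number [k] of rounds is fixed before the error per round, so the total error is at most
   [1]. *)
have [eta' eta'0 keta'] : exists2 eta' : R, 0 < eta' & k%:R * eta' <= 1.
  by exists k.+1%:R^-1; rewrite ?invr_gt0 // ler_pdivrMr // mul1r ler_nat.
pose c Q := ~ HF N Q /\ lam Q = l.
(* [l - eta] must still exceed [lam Q] for all steeper planes. The factor [3 * Kr + 1] collects the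
   growth of the potentials and the change from [l] to [th] over one row. *)
have [eta [eta0 eta_l eta_s eta_Q]] : exists eta, [/\ 0 < eta, eta <= l / 2,
    eta * (3 * Kr + 1) <= eta' & forall Q, lam Q < l -> lam Q < l - eta].
  have [e e0 eP] : exists2 e, 0 < e & forall Q e', 0 < e' -> e' <= e -> lam Q < l -> lam Q < l - e'.
    apply: finite_small => Q; have [lt'|ge] := ltP (lam Q) l; last by exists 1.
    exists ((l - lam Q) / 2) => [|e' h1 h2 _]; lra.
  have [e1 e10 e1P] : exists2 e1, 0 < e1 & forall e, e <= e1 -> e * (3 * Kr + 1) <= eta'.
    have s0 : 0 < 3 * Kr + 1 by lra.
    by exists (eta' / (3 * Kr + 1)) => [|x]; rewrite ?divr_gt0 // ler_pdivlMr.
  exists (Num.min e (Num.min (l / 2) e1)); split.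
  - by rewrite !lt_min e0 e10 andbT /=; lra.
  - by rewrite !ge_min lexx orbT.
  - by apply: e1P; rewrite !ge_min lexx !orbT.
  - move=> Q; apply: eP; last by rewrite ge_min lexx.
    by rewrite !lt_min e0 e10 andbT /=; lra.
pose th := l - eta; have th0 : 0 <= th by rewrite /th; lra.
have [c1 c1P] : exists C : R, forall Q t, C <= t -> ~ HF N Q -> lam Q < l ->
    forall n, (fr Q n)%:~R <= th * n%:R + t :> R.
  apply: finite_bound => Q; have [[nhQ ltQ]|h] := pselect (~ HF N Q /\ lam Q < l); last first.
    by exists 0 => t _ h1 h2; case: h.
  have [C CP] := lam_lt nhQ (eta_Q _ ltQ).
  by exists C => t le _ _ i; apply: le_trans (CP i) _; rewrite lerD2l.
have [c2 c2P] : exists C : R, forall Q t, C <= t -> c Q ->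
    forall n, (fr Q n)%:~R <= (l + eta) * n%:R + t :> R.
  apply: finite_bound => Q; have [[nhQ eqQ]|h] := pselect (c Q); last by exists 0 => t _ /h.
  have [|C CP] := @lam_lt R N Q (l + eta) nhQ; first by rewrite eqQ; lra.
  by exists C => t le _ i; apply: le_trans (CP i) _; rewrite lerD2l.
pose c1' := Num.max c1 0; have c10 : 0 <= c1' by rewrite le_max lexx orbT.
have {}c1P Q := c1P Q c1' ltac:(by rewrite le_max lexx).
have {}c2P Q := c2P Q c2 (lexx _).
pose u Q i : R := (fr Q i)%:~R - th * i%:R.
(* As [th < lam Q], the function [u Q] is unbounded; from [w Q] on its prefix maximum is out of
   reach of steeper planes. *)
have /choice[w wP] : forall Q, exists i, c Q -> c1' + 2 + l < u Q i.
  move=> Q; have [[nhQ eqQ]|h] := pselect (c Q); last by exists 0%N.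
  have [|i] := @lt_lam R N Q th nhQ th0 _ (c1' + 2 + l); first by rewrite eqQ /th; lra.
  by exists i => _; rewrite /u; lra.
pose M Q i := prefix_max (u Q) i.
pose g i := \sum_(Q | `[< c Q >]) M Q i.
pose Kc : R := #|[pred Q | `[< c Q >]]|%:R.
have KcK : Kc <= Kr by rewrite ler_nat max_card.
have gP i : g i <= (Kc * (2 * eta)) * i%:R + Kc * c2.
  apply: le_trans (_ : \sum_(Q | `[< c Q >]) (2 * eta * i%:R + c2) <= _).
    apply: ler_sum => Q /asboolP cQ; have [j ji e] := prefix_max_attained (u Q) i; rewrite /M e.
    have := c2P Q cQ j; have : eta * j%:R <= eta * i%:R :> R by rewrite ler_pM2l // ler_nat.
    rewrite /u /th; lra.
  have dist (x y z k' : R) : (x * y + z) * k' <= k' * x * y + k' * z by lra.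
  by rewrite sumr_const -[leLHS]mulr_natr; apply: dist.
have slope_lt : Kc * (2 * eta) * 1%:R < 3 * Kr * eta.
  have h1 : Kc * eta <= Kr * eta by rewrite ler_pM2r.
  by have h2 : 1 * eta <= Kr * eta; [rewrite ler_pM2r | lra].
(* The sum of the prefix maxima hardly grows at some late row; since each summand is monotone,
   neither does any single one. *)
have [n1 n1P inc] := slow_growth slope_lt gP (\max_Q w Q)%N.
rewrite addn1 in inc.
have Mbig Q : c Q -> c1' + 2 + l < M Q n1.
  move=> cQ; apply: lt_le_trans (wP Q cQ) _; apply: prefix_max_ge.
  by apply: leq_trans n1P; apply: leq_bigmax.
have Minc Q : c Q -> M Q n1.+1 - M Q n1 <= 3 * Kr * eta.
  move=> cQ; apply: le_trans (ltW inc); rewrite /g -sumrB (bigD1 Q) /=; last exact/asboolP.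
  by rewrite lerDl sumr_ge0 // => Q' _; rewrite subr_ge0 prefix_max_mono.
pose phi Q := M Q n1.
have s0 : 0 < 1 + l by lra.
have [Ts Ts0 TsE] : exists2 Ts, 0 <= Ts & Ts * (1 + l) = T'.
  by exists (T' / (1 + l)); rewrite ?divfK ?gt_eqF ?divr_ge0 // ltW.
(* The summand [Ts] keeps the margin [T'] available after the loss of one unit, so a reply out of
   [c] lands in the black region of [TP]. *)
pose cnt Q : R := Ts + #|[pred Q' | `[< c Q' >] && (phi Q <= phi Q')]|%:R.
have cnt_le Q : cnt Q * (1 + l) <= T' + Kr * (1 + l).
  by rewrite /cnt mulrDl TsE lerD2l ler_pM2r // ler_nat max_card.
have cnt_ge Q : c Q -> T' <= (cnt Q - 1) * (1 + l).
  move=> cQ; rewrite -TsE ler_pM2r // /cnt.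
  rewrite -addrA lerDl subr_ge0 ler1n; apply/card_gt0P; exists Q.
  by rewrite inE lexx andbT; apply/asboolP.
have cP : c P by split.
apply: (@black_certificate R N 1 l eta' c phi cnt) => //; [exact: ltW|..]; last 2 first.
- by clear -f_ge; lia.
- rewrite offset1 rmorphD /=; change (n%:~R : R) with (n%:R : R).
  by have := cnt_le P; rewrite /C0 in lt; lra.
- by move=> Q _; rewrite addr_ge0.
- move=> Q Q' cQ cQ' ltQ; rewrite /cnt -addrA lerD2l lerBrDr natr1 ler_nat.
  apply: proper_card; apply/properP; split.
    by apply/fintype.subsetP => q; rewrite !inE => /andP[->] /= /(le_trans (ltW ltQ)).
  by exists Q; rewrite !inE ?lexx ?andbT; [exact/asboolP | rewrite leNgt ltQ andbF].
move=> Q a d p' cQ r.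
have [i ile eM] := prefix_max_attained (u Q) n1; have [nhQ eqQ] := cQ.
have mpos : 0 < fr Q i.
  have := Mbig Q cQ; rewrite /M eM /u -(ltr_int R) => h.
  have : 0 <= th * i%:R by rewrite mulr_ge0. by change (0%:~R : R) with (0 : R); lra.
have bd := effect_bound r.
(* Duplicator copies the reply available at the frontier point that realises the prefix maximum. It
   may lead one row up, hence the comparison of [n1] with [n1.+1]. *)
have [|d' [q' [r' B]]] := blackz_step (proj2 (blackz_fr i nhQ (ltW mpos)) (lexx _)) r.
  by clear -mpos bd; lia.
exists d', q'; split=> // Q'.
have bd' := effect_bound r'; have n0 := blackz_ge0 B.
have m0 : 0 <= fr Q i + d by clear -mpos bd; lia.
pose j : nat := absz (i%:Z + d').
have i' : (j <= n1.+1)%N by rewrite /j; clear -ile bd'; lia.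
have abs_i : (j%:R : R) = i%:R + d'%:~R.
  have -> : (j%:R : R) = j%:Z%:~R by [].
  by have -> : j%:Z = i%:Z + d'; [rewrite /j; clear -n0; lia | rewrite rmorphD].
have /andP[v1 v2] := ler_effect R bd'.
have [cQ'|ncQ'] := pselect (c Q'); [left | right]; split=> //.
  have [nhQ' eqQ'] := cQ'; have := blackz_fr_le nhQ' m0 n0 B.
  rewrite -(ler_int R) rmorphD /= => h.
  have : u Q' j <= M Q' n1.+1 by apply: prefix_max_ge.
  have e2 : phi Q = u Q i := eM.
  have := Minc Q' cQ'; rewrite e2 /phi {1}/u abs_i /u offset1 /th => h1 h2.
  have h3 : eta * -1 <= eta * d'%:~R by rewrite ler_pM2l.
  by rewrite -/j in h; lra.
move=> P0 m n' cP0 m0' n0' h; apply: (TP Q') => //; last first.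
  by apply: lt_le_trans h _; rewrite lerN2; apply: cnt_ge.
(* A steeper plane is excluded: its frontier stays below [th * n + c1'], while the copied reply
   reaches a black point beyond that. *)
move=> [nhQ' leQ']; have ltQ' : lam Q' < l.
  by rewrite lt_neqAle leQ' andbT; apply/eqP => e; apply: ncQ'.
have := blackz_fr_le nhQ' m0 n0 B; rewrite -(ler_int R) rmorphD /= -/j => h1.
have := c1P Q' nhQ' ltQ' j; rewrite abs_i => h2.
have := Mbig Q cQ; rewrite /M eM /u => h3.
have /andP[v3 v4] := ler_effect R bd.
have h4 : th * d'%:~R <= th by rewrite ger_pMr // /th; lra.
by rewrite /th in th0 h1 h2 h3 h4; lra.
Qed.

Lemma lower_belt P : ~ HF N P -> exists C, forall n, lam P * n%:R - C <= (fr P n)%:~R :> R.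
Proof.
have [t] := ubnP #|[pred Q | lam P < lam Q]|.
elim: t P => // t IH P; rewrite ltnS => tP nhP; apply: (lower_belt_step nhP) => Q nhQ lt.
apply: IH => //; apply: leq_trans tP; apply: proper_card; apply/properP; split.
  by apply/fintype.subsetP => q; rewrite !inE; apply: lt_trans.
by exists Q; rewrite !inE ?ltxx.
Qed.

Lemma lower_belt_uniform : exists2 C : R, 0 <= C &
  forall P n, ~ HF N P -> lam P * n%:R - C <= (fr P n)%:~R :> R.
Proof.
have [C CP] : exists C : R, forall P t, C <= t -> ~ HF N P ->
    forall n, lam P * n%:R - t <= (fr P n)%:~R.
  apply: finite_bound => P; have [hP|/lower_belt[C CP]] := pselect (HF N P).
    by exists 0 => t _ [].
  by exists C => t le _ n; apply: le_trans (CP n); rewrite lerD2l lerN2.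
exists (Num.max C 0) => [|P n nhP]; first by rewrite le_max lexx orbT.
by apply: CP => //; rewrite le_max lexx.
Qed.

(** High up, [HF] planes have no white points, and by the lower belt the frontier of a plane with
    larger [lam] runs off to the right of the line at a linear rate. *)
Lemma flatter_far (l : R) : forall B : R, exists n0 : nat, forall Q m (n : int), 0 <= m -> n0%:Z <= n ->
  ~ blackz Q m n -> ~ (~ HF N Q /\ lam Q <= l) -> B <= offset 1 l m n.
Proof.
move=> B; have [K KP] := HF_height N; have [C C0 CP] := lower_belt_uniform.
have [e e0 eP] : exists2 e, 0 < e & forall Q e', 0 < e' -> e' <= e -> l < lam Q -> l + e' <= lam Q.
  apply: finite_small => Q; have [lt|ge] := ltP l (lam Q); last by exists 1.
  by exists (lam Q - l) => [|e' h1 h2 _]; lra.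
have [j jP] := @archi_lt R (B + C) e e0.
exists (maxn K j) => Q m n m0 nge w nle; have [hQ|nhQ] := pselect (HF N Q).
  by case: w; apply: KP => //; clear -nge; lia.
have lt : l < lam Q by rewrite ltNge; apply/negP => h; apply: nle.
have n0 : 0 <= n by clear -nge; lia.
have := white_gt_fr nhQ m0 n0 w; rewrite -(ler_int R) rmorphD /= => h1.
have := CP Q `|n|%N nhQ; have e1 : (`|n|%N%:R : R) = n%:~R.
  by have {2}-> : n = `|n|%N%:Z by clear -n0; lia.
have : (j%:Z%:~R : R) <= n%:~R by rewrite ler_int; clear -nge; lia.
have := eP Q e e0 (lexx _) lt; rewrite e1 offset1 => h2 h3 h4.
have h5 : (l + e) * n%:~R <= lam Q * n%:~R by rewrite ler_wpM2r // ler0z.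
have h6 : j%:R * e <= n%:~R * e by rewrite ler_pM2r.
change (1%:~R : R) with (1 : R) in h1; lra.
Qed.

(** Spoiler's side, by [white_certificate]. The potential of a plane is the infimum of the offsets
    of its first white points from row [n0] on. These infima grow with [n0], but with arbitrarily
    small drift, so for any [j] there is a late [n0] with nearly optimal white points at least [j]
    rows higher. *)
Lemma upper_belt P : ~ HF N P -> exists C, forall n, (fr P n)%:~R <= lam P * n%:R + C :> R.
Proof.
move=> nhP; set l := lam P.
have l0 : 0 <= l := lam_ge0 R nhP.
pose c Q := ~ HF N Q /\ lam Q = l; pose S Q := ~ HF N Q /\ lam Q < l.
have cP : c P by split.
have [C0 C00 CP] := lower_belt_uniform.
have [T TP] : exists T : R, forall Q t, T <= t -> S Q -> forall n, (fr Q n)%:~R <= l * n%:R + t.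
  apply: finite_bound => Q; have [[nhQ lt]|h] := pselect (S Q); last by exists 0 => t _ /h.
  have [C h] := lam_lt nhQ lt.
  by exists C => t le _ n; apply: le_trans (h n) _; rewrite lerD2l.
pose T' := Num.max T 0; have T0 : 0 <= T' by rewrite le_max lexx orbT.
have {}TP Q := TP Q T' ltac:(by rewrite le_max lexx).
pose Kr : R := #|plane N|%:R.
have Kr1 : 1 <= Kr by rewrite ler1n; apply/card_gt0P; exists P.
have s0 : 0 < 1 + l by lra.
have [Ts Ts0 TsE] : exists2 Ts, 0 <= Ts & Ts * (1 + l) = T'.
  by exists (T' / (1 + l)); rewrite ?divfK ?gt_eqF ?divr_ge0 // ltW.
pose v Q n : R := (fr Q n)%:~R + 1 - l * n%:R.
have v_ge Q n : c Q -> 1 - C0 <= v Q n.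
  by move=> [nhQ e]; have := CP Q n nhQ; rewrite e /v; lra.
pose psi n0 Q := inf [set v Q i | i in [set i | (n0 <= i)%N]].
have psi_le n0 Q i : c Q -> (n0 <= i)%N -> psi n0 Q <= v Q i.
  move=> cQ le; apply: ge_inf; last by exists i.
  by exists (1 - C0) => x [k _ <-]; apply: v_ge.
have psi_adh n0 Q e : c Q -> 0 < e -> exists2 i, (n0 <= i)%N & v Q i < psi n0 Q + e.
  move=> cQ e0; have [||x [i le <-] lt] := @inf_lt R [set v Q i | i in [set i | (n0 <= i)%N]] (psi n0 Q + e).
  - by exists (v Q n0), n0 => /=.
  - by rewrite ltrDl.
  - by exists i.
have psi_mono n0 n1 Q : c Q -> (n0 <= n1)%N -> psi n0 Q <= psi n1 Q.
  move=> cQ le; apply: lb_le_inf; first by exists (v Q n1), n1 => /=.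
  by move=> x [i /= le' <-]; apply: psi_le => //; apply: leq_trans le'.
(* The order of the potentials depends on [j], whereas the certificate requires one [cnt]. There are
   finitely many rankings [f], and one that is good for [j] is good for smaller values, so a single
   ranking serves all [j]. *)
pose data (f : {ffun plane N -> 'I_#|plane N|.+1}) (j : nat) := exists (ps : plane N -> R) (n0 : nat),
  [/\ forall Q, c Q -> exists m (n : int), [/\ ~ blackz Q m n, 0 <= m, n0%:Z + j%:Z <= n &
          offset 1 l m n <= ps Q + (j.+1%:R)^-1],
      forall Q P0 m (n : int), c P0 -> ~ S Q -> 0 <= m -> n0%:Z <= n -> ~ blackz Q m n ->
          c Q /\ ps Q <= offset 1 l m n \/ ~ c Q /\ ps P0 <= offset 1 l m n
    & forall Q Q', c Q -> c Q' -> ps Q' < ps Q -> (f Q' < f Q)%N].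
have [||f fP] := @finite_pigeonhole _ data.
- move=> f i j ij [ps [n0 [h1 h2 h3]]]; exists ps, n0; split=> // Q cQ.
  have [m [n [w m0 le h]]] := h1 Q cQ; exists m, n; split=> //; first by clear -le ij; lia.
  by apply: le_trans h _; rewrite lerD2l lef_pV2 ?posrE ?ltr0n // ler_nat.
- move=> j; have [eta eta0 etaj] : exists2 eta : R, 0 < eta & 2 * eta = (j.+1%:R)^-1.
    by exists ((j.+1%:R)^-1 / 2); [rewrite divr_gt0 ?invr_gt0 | rewrite mulrC divfK ?pnatr_eq0].
  (* [e] is the drift granted to frontiers of inverse slope [l]: over [j] rows it costs all planes
     together less than [eta], and flatter planes stay beyond [l + e]. *)
  have [e [e0 ej eQ]] : exists e : R, [/\ 0 < e, Kr * e * j%:R < eta &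
      forall Q, l < lam Q -> l + e < lam Q].
    have [e1 e10 e1P] : exists2 e, 0 < e & forall Q e', 0 < e' -> e' <= e -> l < lam Q -> l + e' < lam Q.
      apply: finite_small => Q; have [lt|ge] := ltP l (lam Q); last by exists 1.
      by exists ((lam Q - l) / 2) => [|e' h1 h2 _]; lra.
    have p0 : 0 < Kr * j.+1%:R by rewrite mulr_gt0 //; lra.
    have [e2 e20 e2P] : exists2 e2, 0 < e2 & Kr * e2 * j%:R < eta.
      exists (eta / (Kr * j.+1%:R)); first by rewrite divr_gt0.
      have -> : Kr * (eta / (Kr * j.+1%:R)) * j%:R = eta * (Kr * j%:R) / (Kr * j.+1%:R) by ring.
      rewrite ltr_pdivrMr // ltr_pM2l // ltr_pM2l ?ltr_nat //; lra.
    exists (Num.min e1 e2); split; first by rewrite lt_min e10.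
      apply: le_lt_trans e2P; rewrite ler_wpM2r // ler_wpM2l ?ge_min ?lexx ?orbT //; lra.
    by move=> Q; apply: e1P; [rewrite lt_min e10 | rewrite ge_min lexx].
  have [C CuP] : exists C : R, forall Q t, C <= t -> c Q -> forall n, (fr Q n)%:~R <= (l + e) * n%:R + t.
    apply: finite_bound => Q; have [[nhQ eqQ]|h] := pselect (c Q); last by exists 0 => t _ /h.
    have [|C h] := @lam_lt R N Q (l + e) nhQ; first by rewrite eqQ; lra.
    by exists C => t le _ n; apply: le_trans (h n) _; rewrite lerD2l.
  have {}CuP Q := CuP Q C (lexx _).
  have v_le Q n : c Q -> v Q n <= e * n%:R + (C + 1).
    by move=> cQ; have := CuP Q cQ n; rewrite /v; lra.
  pose g n := \sum_(Q | `[< c Q >]) psi n Q.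
  pose Kc : R := #|[pred Q | `[< c Q >]]|%:R.
  have KcK : Kc <= Kr by rewrite ler_nat max_card.
  have gP n : g n <= (Kc * e) * n%:R + Kc * (C + 1).
    apply: le_trans (_ : \sum_(Q | `[< c Q >]) (e * n%:R + (C + 1)) <= _).
      by apply: ler_sum => Q /asboolP cQ; apply: le_trans (v_le Q n cQ); apply: psi_le.
    have dist (x y z k : R) : (x * y + z) * k <= k * x * y + k * z by lra.
    by rewrite sumr_const -[leLHS]mulr_natr; apply: dist.
  have slope_lt : Kc * e * j%:R < eta.
    by apply: le_lt_trans ej; rewrite ler_wpM2r // ler_pM2r.
  have [n1 n1P] := flatter_far (l + e) (C + 1).
  have [n0 n0P inc] := slow_growth slope_lt gP n1.
  have Minc Q : c Q -> psi (n0 + j)%N Q - psi n0 Q <= eta.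
    move=> cQ; apply: le_trans (ltW inc); rewrite /g -sumrB (bigD1 Q) /=; last exact/asboolP.
    by rewrite lerDl sumr_ge0 // => Q' /andP[/asboolP cQ' _]; rewrite subr_ge0 psi_mono ?leq_addr.
  exists [ffun Q => inord #|[pred Q' | `[< c Q' >] && (psi n0 Q' < psi n0 Q)]|], (psi n0), n0; split.
  + move=> Q cQ; have [i le h] := psi_adh (n0 + j)%N Q eta cQ eta0; have [nhQ _] := cQ.
    have f_ge := fr_ge i nhQ.
    exists (fr Q i + 1), i; split.
    * by apply: gt_fr_white => //=; clear -f_ge; lia.
    * by clear -f_ge; lia.
    * by clear -le; lia.
    * have := Minc Q cQ; rewrite -etaj offset1 rmorphD /=; rewrite /v in h.
      by change (1%:~R : R) with (1 : R); change (i%:~R : R) with (i%:R : R); lra.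
  + move=> Q P0 m n cP0 nSQ m0 nge w; have n_ge0 : 0 <= n by clear -nge; lia.
    have e1 : (`|n|%N%:R : R) = n%:~R.
      by have {2}-> : n = `|n|%N%:Z by clear -n_ge0; lia.
    have [cQ|ncQ] := pselect (c Q); [left | right]; split=> //.
      have := white_gt_fr (proj1 cQ) m0 n_ge0 w; rewrite -(ler_int R) rmorphD /= => h.
      apply: le_trans (psi_le n0 Q `|n|%N cQ _) _; first by clear -nge; lia.
      by rewrite /v e1 offset1; change (1%:~R : R) with (1 : R) in h; lra.
    (* A white point of a flatter or [HF] plane lies beyond [C + 1] even with respect to inverse
       slope [l + e]; the extra [e * n] covers the drift of [v P0 n0]. *)
    apply: le_trans (psi_le n0 P0 n0 cP0 (leqnn _)) _; apply: le_trans (v_le P0 n0 cP0) _.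
    have h := n1P Q m n m0 ltac:(by clear -n0P nge; lia) w.
    have : C + 1 <= offset 1 (l + e) m n.
      apply: h => -[nhQ]; apply/negP; rewrite -ltNge; apply: eQ.
      rewrite lt_neqAle eq_sym; apply/andP; split; first by apply/eqP => eqQ; apply: ncQ.
      by rewrite leNgt; apply/negP => lt; apply: nSQ.
    have h2 : e * n0%:R <= e * n%:~R by rewrite ler_pM2l // -[n0%:R]/(n0%:Z%:~R) ler_int.
    by rewrite !offset1; lra.
  + move=> Q Q' cQ cQ' lt; rewrite !ffunE !inordK ?ltnS ?max_card //.
    apply: proper_card; apply/properP; split.
      by apply/fintype.subsetP => q; rewrite !inE => /andP[->] /= /lt_trans; apply.
    by exists Q'; rewrite !inE ?ltxx ?andbF // lt andbT; apply/asboolP.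
(* The final [1] leaves the margin [T'] of the steeper planes in [S] intact after the loss of one
   unit. *)
pose cnt Q : R := Ts + (f Q)%:R + 1.
have cnt0 Q : 0 <= cnt Q by rewrite !addr_ge0.
have white m (n : int) : 0 <= m -> cnt P * (1 + l) < offset 1 l m n -> ~ blackz P m n.
  apply: (@white_certificate R N 1 l c S cnt) => //.
  - move=> Q P0 i k [nhQ ltQ] cP0 i0 k0; rewrite offset1 => h; apply: gt_fr_white => //.
    rewrite -(ltr_int R); have := TP Q (conj nhQ ltQ) `|k|%N.
    have -> : (`|k|%N%:R : R) = k%:~R by have {2}-> : k = `|k|%N%:Z by clear -k0; lia.
    have : 0 <= (f P0)%:R * (1 + l) by rewrite mulr_ge0 // ltW.
    by rewrite /cnt in h; lra.
  - move=> j; have [ps [n0 [h1 h2 h3]]] := fP j; exists ps, n0; split=> // Q Q' cQ cQ' lt.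
    have := h3 Q Q' cQ cQ' lt; rewrite /cnt -(ler_nat R) -natr1; lra.
exists (cnt P * (1 + l)) => n; rewrite leNgt; apply/negP => lt.
have fpos : 0 <= fr P n.
  apply: ltW; rewrite -(ltr_int R); apply: le_lt_trans lt.
  by rewrite addr_ge0 ?mulr_ge0 // ltW.
apply: (white (fr P n) n fpos); last by apply/(blackz_fr _ nhP fpos).
by rewrite offset1; change (n%:~R : R) with (n%:R : R); lra.
Qed.

End Belts.

(** * Rationality of the slopes *)

Section Limsup.
Variable R : realType.
Implicit Types u : nat -> R.

Definition is_limsup u h := forall e, 0 < e ->
  (exists n0, forall n, (n0 <= n)%N -> u n <= h + e) /\
  (forall n0, exists2 n, (n0 <= n)%N & h - e <= u n).

Lemma limsup_ex u B : (forall n, `|u n| <= B) -> exists h, is_limsup u h.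
Proof.
move=> ub; pose S := [set x | exists n0, forall n, (n0 <= n)%N -> u n <= x].
have lbS x : S x -> - B <= x.
  by move=> [n0 /(_ n0 (leqnn _))]; have := ub n0; rewrite ler_norml => /andP[h _]; apply: le_trans.
have S0 : S !=set0.
  by exists B, 0%N => n _; have := ub n; rewrite ler_norml => /andP[].
exists (inf S) => e e0; split.
  have [|x [n0 h] lt] := @inf_lt R S (inf S + e) S0; first by rewrite ltrDl.
  by exists n0 => n /h le; apply: le_trans le (ltW lt).
move=> n0; apply: contrapT => nex; have : S (inf S - e).
  exists n0 => n le; rewrite leNgt; apply/negP => lt; apply: nex; exists n => //; exact: ltW.
move=> Se; have : inf S <= inf S - e by apply: ge_inf => //; exists (- B).
by rewrite lerBrDl gerDr leNgt e0.
Qed.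

End Limsup.

Section Cycle.
Variables (R : realType) (N : ocn).
Implicit Types (P Q : plane N) (m d : int) (n : nat) (t : R).

Local Notation lam := (@lam R N).

Definition excess P n : R := (fr P n)%:~R - lam P * n%:R.

Lemma excess_bound P : ~ HF N P -> exists B, forall n, `|excess P n| <= B.
Proof.
move=> nhP; have [C CP] := upper_belt R nhP; have [C0 _ C0P] := lower_belt_uniform R N.
exists (`|C| + `|C0|) => n; rewrite ler_norml /excess.
have := CP n; have := C0P P n nhP; have := ler_norm C; have := ler_norm C0.
by have := normr_ge0 C; have := normr_ge0 C0 => *; apply/andP; split; lra.
Qed.

Lemma steeper_far (l B : R) : exists n0 : nat, forall Q m (n : int), 0 <= m -> n0%:Z <= n ->
  ~ HF N Q -> lam Q < l -> blackz Q m n -> offset 1 l m n <= - B.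
Proof.
have /choice[f fP] : forall Q, exists k : nat, forall n, (k <= n)%N -> ~ HF N Q -> lam Q < l ->
    (fr Q n)%:~R - l * n%:R <= - B.
  move=> Q.
  have [[nhQ lt]|h] := pselect (~ HF N Q /\ lam Q < l); last first.
    by exists 0%N => n _ h1 h2; case: h.
  have [|C CP] := @lam_lt R N Q ((lam Q + l) / 2) nhQ; first lra.
  have [j jP] := @archi_lt R (C + B) ((l - lam Q) / 2) ltac:(lra).
  exists j => n le _ _; have := CP n; have : j%:R <= n%:R :> R by rewrite ler_nat.
  have : j%:R * ((l - lam Q) / 2) <= n%:R * ((l - lam Q) / 2).
    by rewrite ler_pM2r ?ler_nat //; lra.
  by lra.
exists (\max_Q f Q)%N => Q m n m0 le nhQ lt b.
have n0 : 0 <= n by clear -le; lia.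
have := blackz_fr_le nhQ m0 n0 b; rewrite -(ler_int R) => h.
have := fP Q `|n|%N; have -> : (`|n|%N%:R : R) = n%:~R by have {2}-> : n = `|n|%N%:Z by clear -n0; lia.
rewrite offset1 => /(_ _ nhQ lt) h'; apply: le_trans (h' _); first by rewrite lerD2r.
have : (f Q <= \max_Q f Q)%N by apply: leq_bigmax.
by clear -le n0; lia.
Qed.

Lemma exact_rank P m (n : int) k : 0 <= n -> ~ survives k P m n ->
  exists k', [/\ (k' < k)%N, survives k' P m n & ~ survives k'.+1 P m n].
Proof.
move=> n0; elim: k => [|k IH] wk; first by case: wk; split.
have [s|/IH[k' [lt s w]]] := pselect (survives k P m n); first by exists k.
by exists k'; split=> //; apply: ltnW.
Qed.

(* Two tokens with constant displacement: Spoiler wins from the white one, Duplicator holds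
   the black one. Their distance forces them to stay in planes of maximal span, and the
   exact rank of the white token decreases, so the same plane is revisited at another
   point of the same line. *)
Lemma slope_cycle (l : R) (hi lo : plane N -> R) (ms : {set plane N}) P0 :
  0 < l -> ~ HF N P0 -> lam P0 = l ->
  (forall P, ~ HF N P -> lam P = l -> is_limsup (excess P) (hi P)) ->
  (forall P, ~ HF N P -> lam P = l -> is_limsup (fun n => - excess P n) (- lo P)) ->
  (forall P, ~ HF N P -> lam P = l ->
     (forall Q, ~ HF N Q -> lam Q = l -> hi Q - lo Q <= hi P - lo P) -> P \in ms) ->
  exists dx dy : nat, [/\ (1 <= dx <= #|ms|)%N, (1 <= dy <= #|ms|)%N & l * dy%:R = dx%:R].
Proof.
move=> l0 nhP0 lamP0 hiP loP msP.
pose c P := ~ HF N P /\ lam P = l.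
have cP0 : c P0 by [].
have [P1 cP1 maxP1] : exists2 P, c P & forall Q, c Q -> hi Q - lo Q <= hi P - lo P.
  have /asboolP cP0' := cP0.
  case: (@Order.TotalTheory.arg_maxP _ _ _ P0 (fun P => `[< c P >]) (fun P => hi P - lo P)) => //.
  by move=> P /asboolP cP h; exists P => // Q /asboolP; apply: h.
pose D := hi P1 - lo P1; pose K := #|ms|.
(* [4 * e] is below the distance from [D] to any smaller span and below any nonzero offset of a
   displacement by at most [K] in each coordinate; approximate equalities thus become exact. *)
have [e [e0 e1 eD eK]] : exists e, [/\ 0 < e, e <= 1,
    forall P, c P -> hi P - lo P < D -> hi P - lo P + 4 * e < D
  & forall x y : int, (`|x| <= K%:Z) -> (`|y| <= K%:Z) -> x%:~R - l * y%:~R != 0 ->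
      4 * e < `|x%:~R - l * y%:~R|].
  have [e1 e10 e1P] : exists2 e, 0 < e & forall P e', 0 < e' -> e' <= e ->
      hi P - lo P < D -> hi P - lo P + 4 * e' < D.
    apply: finite_small => P; have [lt|ge] := ltP (hi P - lo P) D; last by exists 1.
    by exists ((D - (hi P - lo P)) / 5) => [|e' h1 h2 _]; lra.
  pose val (i : 'I_(K + K).+1) : int := i%:Z - K%:Z.
  have [e2 e20 e2P] : exists2 e, 0 < e & forall (xy : 'I_(K + K).+1 * 'I_(K + K).+1) e', 0 < e' -> e' <= e ->
      (val xy.1)%:~R - l * (val xy.2)%:~R != 0 -> 4 * e' < `|(val xy.1)%:~R - l * (val xy.2)%:~R|.
    apply: finite_small => xy; set z := _ - _; have [->|nz] := eqVneq z 0; first by exists 1.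
    have z0 : 0 < `|z| by rewrite normr_gt0.
    by exists (`|z| / 5) => [|e' h1 h2 _]; lra.
  exists (Num.min 1 (Num.min e1 e2)); split.
  - by rewrite !lt_min e10 e20 ltr01.
  - by rewrite ge_min lexx.
  - move=> P _; apply: e1P; first by rewrite !lt_min e10 e20 ltr01.
    by rewrite !ge_min lexx !orbT.
  - move=> x y hx hy; pose x' : nat := absz (x + K%:Z); pose y' : nat := absz (y + K%:Z).
    have hx' : (x' < (K + K).+1)%N by rewrite /x'; clear -hx; lia.
    have hy' : (y' < (K + K).+1)%N by rewrite /y'; clear -hy; lia.
    have := e2P (Ordinal hx', Ordinal hy') (Num.min 1 (Num.min e1 e2)).
    have -> : val (Ordinal hx') = x by rewrite /val /= /x'; clear -hx; lia.
    have -> : val (Ordinal hy') = y by rewrite /val /= /y'; clear -hy; lia.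
    by apply; rewrite ?lt_min ?e10 ?e20 ?ltr01 // !ge_min lexx !orbT.
have [B BP] : exists B : R, forall P t, B <= t -> `|lo P| + `|hi P| + 10 + 2 * (1 + l) <= t.
  by apply: finite_bound => P; exists (`|lo P| + `|hi P| + 10 + 2 * (1 + l)).
have {}BP P := BP P B (lexx _).
have Blo P : [/\ lo P <= B - 10 - 2 * (1 + l), - B + 10 + 2 * (1 + l) <= lo P,
    hi P <= B - 10 - 2 * (1 + l) & - B + 10 + 2 * (1 + l) <= hi P].
  have := BP P; have := ler_norm (lo P); have := ler_norm (hi P).
  have := ler_norm (- lo P); have := ler_norm (- hi P); rewrite !normrN.
  by have := normr_ge0 (lo P); have := normr_ge0 (hi P) => *; split; lra.
have [n1 n1P] := @flatter_far R N l B.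
have [n2 n2P] := steeper_far l B.
have /choice[n3 n3P] : forall P, exists k : nat, c P -> forall n, (k <= n)%N -> lo P - e <= excess P n <= hi P + e.
  move=> P; have [[nhP eP]|h] := pselect (c P); last by exists 0%N.
  have [[k1 h1] _] := hiP P nhP eP e e0; have [[k2 h2] _] := loP P nhP eP e e0.
  exists (maxn k1 k2) => _ n le; apply/andP; split.
    by have := h2 n ltac:(by rewrite (leq_trans _ le) // leq_maxr); lra.
  by apply: h1; rewrite (leq_trans _ le) // leq_maxl.
have [j jP] := @archi_lt R (3 * B + 10) l l0.
pose n4 := (n1 + n2 + \max_P n3 P + j)%N.
have [nhP1 lamP1] := cP1.
(* The white token starts just right of a frontier point near [lo P1], the black one at a frontier
   point near [hi P1]; [K] spare rows allow for [K] moves. *)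
have [ny nyP hy] := (loP P1 nhP1 lamP1 e e0).2 (n4 + K).+1%N.
have [nx nxP hx] := (hiP P1 nhP1 lamP1 e e0).2 (n4 + K).+1%N.
pose wx := fr P1 nx - (fr P1 ny + 1); pose wy : int := nx%:Z - ny%:Z.
pose E := offset 1 l.
have Ew : D - 1 - 2 * e <= E wx wy.
  rewrite /E offset1 /wx /wy !rmorphB rmorphD /=; move: hx hy; rewrite /excess lamP1 /D.
  change (1%:~R : R) with (1 : R); change (nx%:~R : R) with (nx%:R : R).
  by change (ny%:~R : R) with (ny%:R : R); lra.
pose st := (nat * plane N * int * int * nat)%type.
(* In a state, [t] counts the moves made, [(m, n)] is the white token of exact rank [k], and the
   black token is displaced from it by [(wx, wy)]. *)
pose inv (s : st) := let: (t, P, m, n, k) := s in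
  [/\ [/\ 0 <= m, 0 <= m + wx, survives k P m n & ~ survives k.+1 P m n],
      blackz P (m + wx) (n + wy), c P, (t <= K)%N
    & (n4 + K)%:Z <= n + t%:Z /\ (n4 + K)%:Z <= n + wy + t%:Z].
have far_white P m (n : int) : c P -> 0 <= m -> n4%:Z <= n -> ~ blackz P m n -> lo P + 1 - e <= E m n.
  move=> cP m0 ge w; have n_ge0 : 0 <= n by clear -ge; lia.
  have := white_gt_fr (proj1 cP) m0 n_ge0 w; rewrite -(ler_int R) rmorphD /= => h.
  have : (n3 P <= `|n|)%N by have := leq_bigmax (F := n3) P; rewrite /n4 in ge; clear -ge n_ge0; lia.
  move=> /(n3P P cP)/andP[h1 _]; rewrite /excess (proj2 cP) in h1.
  have en : (`|n|%N%:R : R) = n%:~R by have {2}-> : n = `|n|%N%:Z by clear -n_ge0; lia.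
  by rewrite en in h1; rewrite /E offset1; change (1%:~R : R) with (1 : R) in h; lra.
have far_black P m (n : int) : c P -> 0 <= m -> n4%:Z <= n -> blackz P m n -> E m n <= hi P + e.
  move=> cP m0 ge b; have n_ge0 : 0 <= n by clear -ge; lia.
  have := blackz_fr_le (proj1 cP) m0 n_ge0 b; rewrite -(ler_int R) => h.
  have : (n3 P <= `|n|)%N by have := leq_bigmax (F := n3) P; rewrite /n4 in ge; clear -ge n_ge0; lia.
  move=> /(n3P P cP)/andP[_ h1]; rewrite /excess (proj2 cP) in h1.
  have en : (`|n|%N%:R : R) = n%:~R by have {2}-> : n = `|n|%N%:Z by clear -n_ge0; lia.
  by rewrite en in h1; rewrite /E offset1; lra.
have EwD m (n : int) : E (m + wx) (n + wy) = E m n + E wx wy by apply: offsetD.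
(* Whiteness bounds the offset from below through [lo P], blackness of the other token from above
   through [hi P]. So the span of [P] is at least [D - 4 * e], hence equal to [D], and the offset is
   confined to an interval of length [4 * e]. *)
have inv_ms s : inv s -> let: (t, P, m, n, k) := s in
    [/\ P \in ms, lo P + 1 - e <= E m n, E m n <= lo P + 1 + 3 * e, 0 <= n & n4%:Z <= n /\ n4%:Z <= n + wy].
  case: s => [[[[t P] m] n] k] [[m0 mx0 sk wk] b cP tK [nK nxK]].
  have h1 : n4%:Z <= n by clear -tK nK; lia.
  have h2 : n4%:Z <= n + wy by clear -tK nxK; lia.
  have h3 := far_white P m n cP m0 h1 (not_survives_white wk).
  have h4 := far_black P _ _ cP mx0 h2 b; rewrite EwD in h4.
  have ge : D <= hi P - lo P.
    by rewrite leNgt; apply/negP => /(eD P cP); lra.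
  have le := maxP1 P cP.
  split=> //; [|by rewrite /D in Ew ge; lra|by clear -h1; lia].
  have [nhP eP] := cP; apply: msP => // Q nhQ eQ; apply: le_trans ge; exact: maxP1.
have step s : exists s', inv s -> (s.1.1.1.1 < K)%N ->
    [/\ inv s', s'.1.1.1.1 = s.1.1.1.1.+1, (s'.2 < s.2)%N, `|s'.1.1.2 - s.1.1.2| <= 1
      & `|s'.1.2 - s.1.2| <= 1].
  have [[invs tK]|h] := pselect (inv s /\ (s.1.1.1.1 < K)%N); last by exists s => h1 h2; case: h.
  move: s invs tK => [[[[t P] m] n] k] invs /= tK.
  have [_ E1 E2 n0 [f1 f2]] := inv_ms _ invs.
  case: invs => [[m0 mx0 sk wk] b cP _ [nK nxK]].
  have [a [d [p' [r md h]]]] := not_survives_step n0 wk.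
  have bd := effect_bound r; have [Blo1 Blo2 Bhi1 Bhi2] := Blo P.
  have mx : 0 < m + wx.
    rewrite -(ltr_int R); have := EwD m n; rewrite {1}/E offset1 => e3.
    have : (n4%:Z%:~R : R) <= (n + wy)%:~R by rewrite ler_int.
    rewrite -(ler_pM2l l0) => h1.
    have h2 : l * j%:R <= l * n4%:Z%:~R.
      by rewrite ler_pM2l // ler_nat /n4 leq_addl.
    have [P1lo1 P1lo2 P1hi1 P1hi2] := Blo P1; rewrite /D in Ew.
    by change (0%:~R : R) with (0 : R); rewrite mulrC in jP; lra.
  have [|d' [q' [r' b']]] := blackz_step b r; first by clear -mx bd; lia.
  have bd' := effect_bound r'; have w' := h _ _ r'.
  pose Q := (p', q').
  have n0' : n4%:Z <= n + d' by clear -nK tK bd'; lia.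
  have nx0' : n4%:Z <= n + d' + wy by clear -nxK tK bd'; lia.
  have mx0' : 0 <= m + d + wx by clear -mx bd; lia.
  have n0'' : 0 <= n + d' by clear -n0'; lia.
  have b'' : blackz Q (m + d + wx) (n + d' + wy).
    have -> : m + d + wx = m + wx + d by clear; lia.
    by have -> : n + d' + wy = n + wy + d' by clear; lia.
  have /andP[v1 v2] := @offset_effect R 1 l d d' ler01 (ltW l0) bd bd'.
  have E' := offsetD 1 l m n d d'; rewrite -/E in E' v1 v2 E1 E2.
  (* In a flatter or [HF] plane the white token would have to be far right of the line, in a steeper
     plane the black token far left of it; both stay near it. *)
  have cQ : c Q.
    have [nle|le] := pselect (~ (~ HF N Q /\ lam Q <= l)).
      have := n1P Q (m + d) (n + d') md _ (not_survives_white w') nle.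
      rewrite -/E => h'; have := h' ltac:(by rewrite /n4 in n0'; clear -n0'; lia).
      by lra.
    have [nhQ leQ] := contrapT le; split=> //; apply/eqP; rewrite eq_le leQ leNgt.
    apply/negP => ltQ; have := n2P Q _ _ mx0' _ nhQ ltQ b''.
    rewrite -/E => h'; have := h' ltac:(by rewrite /n4 in nx0'; clear -nx0'; lia).
    have [P1lo1 P1lo2 P1hi1 P1hi2] := Blo P1; rewrite /D in Ew.
    by rewrite EwD E'; have := maxP1 P cP; lra.
  have [k' [kk' sk' wk']] := exact_rank n0'' w'.
  exists (t.+1, Q, m + d, n + d', k') => _ _; split=> //=.
  - split=> //; split=> //; clear -nK nxK bd'; lia.
  - by clear -bd; lia.
  - by clear -bd'; lia.
have /choice[nxt nxtP] := step.
have f_ge := fr_ge ny nhP1.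
have w0 : ~ blackz P1 (fr P1 ny + 1) ny by apply: gt_fr_white => //=; clear -f_ge; lia.
have [k0 wk0] := whiteP w0.
have [k1 [_ sk1 wk1]] := @exact_rank P1 _ ny%:Z _ isT wk0.
pose s0 : st := (0%N, P1, fr P1 ny + 1, ny%:Z, k1).
have fx0 : 0 <= fr P1 nx.
  have h1 : j%:R * l <= nx%:R * l.
    by rewrite ler_pM2r // ler_nat; rewrite /n4 in nxP; clear -nxP; lia.
  move: hx; rewrite /excess lamP1 => h2; have [P1lo1 P1lo2 P1hi1 P1hi2] := Blo P1.
  by rewrite -(ler_int R); change (0%:~R : R) with (0 : R); lra.
have inv0 : inv s0.
  have ex : fr P1 ny + 1 + wx = fr P1 nx by rewrite /wx; clear; lia.
  have ey : ny%:Z + wy = nx by rewrite /wy; clear; lia.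
  rewrite /inv /s0 ex ey; split => //; last by clear -nxP nyP; lia.
    by split=> //; clear -f_ge; lia.
  by apply/(blackz_fr nx nhP1 fx0).
pose seqs i := iter i nxt s0.
have seqsP i : (i <= K)%N -> inv (seqs i) /\ (seqs i).1.1.1.1 = i.
  elim: i => [|i IH] le //; have [h1 h2] := IH (ltnW le).
  by have [] := nxtP (seqs i) h1 _; rewrite h2 // => h3 h4 _ _ _; split=> //; rewrite h4.
have seqsS i : (i < K)%N -> [/\ ((seqs i.+1).2 < (seqs i).2)%N, `|(seqs i.+1).1.1.2 - (seqs i).1.1.2| <= 1
      & `|(seqs i.+1).1.2 - (seqs i).1.2| <= 1].
  move=> le; have [h1 h2] := seqsP i (ltnW le).
  by have [] := nxtP (seqs i) h1 _; rewrite h2.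
have seqsD i (d : nat) : (i + d <= K)%N -> [/\ ((seqs (i + d)%N).2 + d <= (seqs i).2)%N,
    `|(seqs (i + d)%N).1.1.2 - (seqs i).1.1.2| <= d%:Z & `|(seqs (i + d)%N).1.2 - (seqs i).1.2| <= d%:Z].
  elim: d => [|d IH] le; first by rewrite !addn0; split; rewrite ?subrr.
  rewrite addnS in le *; have [h1 h2 h3] := IH (ltnW le); have [h4 h5 h6] := seqsS _ le.
  by split; [clear -h1 h4; lia | clear -h2 h5; lia | clear -h3 h6; lia].
(* [K + 1] states visit only the [K] planes of [ms]. *)
have [i [d [d0 idK eP]]] : exists i d : nat, [/\ (0 < d)%N, (i + d <= K)%N &
    (seqs i).1.1.1.2 = (seqs (i + d)%N).1.1.1.2].
  pose f (i : 'I_K.+1) := (seqs i).1.1.1.2.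
  have fms i : f i \in ms.
    have [h _] := seqsP i (leq_ord i); move: (inv_ms _ h); rewrite /f.
    by case: (seqs i) => [[[[t P] m] n] k] [].
  have /injectivePn[x [y xy fxy]] : ~~ injectiveb f.
    apply/negP => /injectiveP /card_codom; rewrite card_ord => cardf.
    have : (#|codom f| <= K)%N by apply/subset_leq_card/fintype.subsetP => _ /codomP[i ->].
    by rewrite cardf ltnn.
  wlog lt : x y xy fxy / (x < y)%N.
    move=> H; have [lt|lt|/val_inj e'] := ltngtP x y; first exact: (H x y).
      by apply: (H y x); rewrite // eq_sym.
    by rewrite e' eqxx in xy.
  exists x, (y - x)%N; rewrite subnKC ?(ltnW lt) // subn_gt0 lt leq_ord.
  by split.
have [invi _] := seqsP i ltac:(by clear -idK; lia).
have [invj _] := seqsP _ idK.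
have [h1 h2 h3] := seqsD i d idK.
move: (seqs i) (seqs (i + d)%N) invi invj eP h1 h2 h3 => s1 s2.
case: s1 => [[[[t P] m] n] k]; case: s2 => [[[[t' P'] m'] n'] k'] invi invj /= eP h1 h2 h3.
subst P'; have [_ E1 E2 _ _] := inv_ms _ invi; have [_ E3 E4 _ _] := inv_ms _ invj.
have cE : (m' - m)%:~R - l * (n' - n)%:~R = E m' n' - E m n.
  by rewrite /E !offset1 !rmorphB /=; lra.
have dK : d%:Z <= K%:Z by clear -idK; lia.
(* Both visits lie in the same interval of length [4 * e], so by [eK] their displacement is parallel
   to the line. *)
have c0 : (m' - m)%:~R - l * (n' - n)%:~R = 0 :> R.
  apply/eqP; apply: contraT => /(eK _ _ (le_trans h2 dK) (le_trans h3 dK)); rewrite cE.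
  rewrite ltNge ler_norml => /negP h; exfalso; apply: h; apply/andP; split; lra.
(* The same point cannot recur, because the exact rank strictly decreases. *)
have nz : n' - n != 0.
  apply/eqP => n0; rewrite n0 mulr0 subr0 in c0.
  have m0 : m' - m = 0 by apply/eqP; rewrite -(intr_eq0 R) c0.
  have em : m' = m by clear -m0; lia.
  have en : n' = n by clear -n0; lia.
  move: invi invj => [[_ _ sk _] _ _ _ _] [[_ _ _ wk] _ _ _ _]; apply: wk; rewrite em en.
  by apply: survives_anti sk; clear -h1 d0; lia.
have eq1 : (m' - m)%:~R = l * (n' - n)%:~R :> R by lra.
have mz : m' - m != 0.
  rewrite -(intr_eq0 R) eq1 mulf_neq0 ?intr_eq0 //; exact: lt0r_neq0.
exists (absz (m' - m)), (absz (n' - n)); split.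
- by rewrite -/K; move: dK h2 mz; clear; move: K => K; lia.
- by rewrite -/K; move: dK h3 nz; clear; move: K => K; lia.
have abs (z : int) : ((absz z)%:R : R) = `|z%:~R|.
  by rewrite -intr_norm.
by rewrite !abs eq1 normrM (gtr0_norm l0).
Qed.

End Cycle.

(** * Distances to the lines *)

Lemma infinite_natP (A : set nat) :
  infinite_set A <-> forall n0, exists2 n, (n0 <= n)%N & A n.
Proof.
split=> [inf n0|h /finite_seqP[s As]].
  apply: contrapT => nex; apply: inf; apply: (sub_finite_set _ (finite_II n0)) => n An /=.
  by rewrite ltnNge; apply/negP => le; apply: nex; exists n.
have [b bP] : exists b, forall x, x \in s -> (x < b)%N.
  elim: s {As} => [|y s [b bP]]; first by exists 0%N.
  by exists (maxn b y.+1) => x; rewrite inE leq_max => /orP[/eqP->|/bP->] //; rewrite leqnn orbT.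
have [n le An] := h b; have : n \in s by move: An; rewrite As.
by move=> /bP; rewrite ltnNge le.
Qed.

Lemma int_limsup (z : nat -> int) (B : nat) : (forall n, `|z n| <= B%:Z) ->
  exists h, (exists n0, forall n, (n0 <= n)%N -> z n <= h) /\
    forall n0, exists2 n, (n0 <= n)%N & z n = h.
Proof.
move=> zB; pose S := [set i : nat | forall n0, exists2 n, (n0 <= n)%N & i%:Z <= z n + B%:Z].
have [||i [Si maxi]] := @nat_set_max S (B + B)%N.
- by exists 0%N => n0; exists n0 => //; have := zB n0; lia.
- by move=> i /(_ 0%N)[n _]; have := zB n; lia.
have nS : ~ S i.+1 by move=> /maxi; rewrite ltnn.
have [n0 n0P] : exists n0, forall n, (n0 <= n)%N -> z n + B%:Z <= i%:Z.
  apply: contrapT => nex; apply: nS => n0; apply: contrapT => h; apply: nex; exists n0 => n le.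
  by rewrite leNgt; apply/negP => lt; apply: h; exists n => //; lia.
exists (i%:Z - B%:Z); split; first by exists n0 => n /n0P; lia.
move=> n1; have [n le h] := Si (maxn n0 n1).
exists n; first by rewrite (leq_trans _ le) // leq_maxr.
by have := n0P n ltac:(by rewrite (leq_trans _ le) // leq_maxl); lia.
Qed.

Section Distance.
Variable R : realType.
Implicit Types (u v : R * R) (l : R).

(** Completing the square ([key]) shows where the distance is attained. Parametrising by the second
    coordinate covers vertical lines as [l = 0]. *)
Lemma dist_to_line l u : 0 <= l ->
  inf [set eucl u v | v in [set v | v.1 = l * v.2]] = `|u.1 - l * u.2| / Num.sqrt (1 + l ^+ 2).
Proof.
move=> l0; set D := u.1 - l * u.2; set q := 1 + l ^+ 2.
have q0 : 0 < q by rewrite ltr_pwDl // sqr_ge0.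
have sq0 : 0 < Num.sqrt q by rewrite sqrtr_gt0.
have valE : `|D| / Num.sqrt q = Num.sqrt (D ^+ 2 / q).
  by rewrite sqrtrM ?sqr_ge0 // sqrtr_sqr sqrtrV // ltW.
have key s : D ^+ 2 / q + q * (s - l * D / q) ^+ 2 = (D - l * s) ^+ 2 + s ^+ 2.
  by rewrite /q; field; exact: lt0r_neq0.
pose v0 := (l * (u.2 + l * D / q), u.2 + l * D / q).
have val s : eucl u (l * (u.2 + s), u.2 + s) = Num.sqrt ((D - l * s) ^+ 2 + s ^+ 2).
  by rewrite /eucl /D /=; congr Num.sqrt; ring.
rewrite valE; apply/eqP; rewrite eq_le; apply/andP; split.
  apply: ge_inf; first by exists 0 => _ [v _ <-]; apply: sqrtr_ge0.
  by exists v0 => //; rewrite val -key subrr expr0n mulr0 addr0.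
apply: lb_le_inf; first by exists (eucl u v0), v0.
move=> _ [[v1 v2] /= -> <-]; have -> : v2 = u.2 + (v2 - u.2) by ring.
rewrite val -key; apply: ler_wsqrtr; rewrite lerDl mulr_ge0 ?sqr_ge0 //; exact: ltW.
Qed.

Lemma dist_signed (ell : line R) l u : 0 <= l -> (forall y, line_inv ell y = l * y) ->
  line_points ell = [set v | v.1 = l * v.2] ->
  dist u ell = (u.1 - l * u.2) / Num.sqrt (1 + l ^+ 2).
Proof.
move=> l0 inv pts; rewrite /dist inv pts dist_to_line //.
have [lt|ge] := ltP u.1 (l * u.2).
  by rewrite ltr0_norm ?subr_lt0 // mulNr opprK.
by rewrite ger0_norm // subr_ge0.
Qed.

Lemma dist_graph a u : 0 < a ->
  dist u (Graph a 0) = (u.1 - a^-1 * u.2) / Num.sqrt (1 + a^-1 ^+ 2).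
Proof.
move=> a0; apply: dist_signed; first by rewrite invr_ge0 ltW.
  by move=> y /=; rewrite subr0 mulrC.
apply/seteqP; split=> -[v1 v2] /= => [->|->].
  by rewrite addr0 mulKf ?gt_eqF.
by rewrite mulVKf ?gt_eqF // addr0.
Qed.

Lemma dist_vertical u : dist u (Vertical 0) = u.1 - 0 * u.2.
Proof.
have := @dist_signed (Vertical 0) 0 u (lexx 0).
rewrite expr0n addr0 sqrtr1 divr1; apply=> [y|]; first by rewrite mul0r.
by apply/seteqP; split=> -[v1 v2] /= ->; rewrite mul0r.
Qed.

End Distance.

(** * Slope and recurrent extrema of a single plane *)

Section Planes.
Variables (R : realType) (N : ocn).
Implicit Types (P Q : plane N) (m d : int) (n : nat) (t : R).

Local Notation lam := (@lam R N).
Local Notation excess := (@excess R N).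

(** A vanishing growth rate alone would still allow slow unbounded growth; [upper_belt] excludes
    it. *)
Lemma VFP P : VF N P <-> ~ HF N P /\ lam P = 0.
Proof.
split=> -[nhP].
  move=> [c cP]; split=> //; apply/eqP; rewrite eq_le lam_ge0 // andbT.
  apply: lam_le => //; exists c%:~R => n; rewrite mul0r add0r ler_int.
  have [e _ _] := frP (@not_HFP N P nhP n); by have := cP n; rewrite e lee_fin.
move=> l0; split=> //; have [C CP] := upper_belt R nhP; exists (Num.bound `|C|)%:Z => n.
have [e _ _] := frP (@not_HFP N P nhP n); rewrite e lee_fin -(ler_int R).
have := CP n; rewrite l0 mul0r add0r => /le_trans; apply.
by apply: le_trans (ler_norm _) _; apply: ltW; apply: archi_boundP.
Qed.

Lemma SFP P : SF N P <-> ~ HF N P /\ 0 < lam P.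
Proof.
split=> -[nhP].
  by move=> nv; split=> //; rewrite lt_neqAle lam_ge0 // andbT eq_sym; apply/eqP => e; apply: nv; apply/VFP.
by move=> l0; split=> // /VFP[_ e]; rewrite e ltxx in l0.
Qed.

Lemma VF_or_SF P : (VF N `|` SF N) P <-> ~ HF N P.
Proof.
split=> [[[]|[]]//|nhP]; have := lam_ge0 R nhP; rewrite le_eqVlt => /orP[/eqP e|lt].
  by left; apply/VFP.
by right; apply/SFP.
Qed.

(** A first use of [slope_cycle], with approximate limits and all planes as [ms]. Rationality comes
    first: it shows that the extrema are attained, on which the sharp count in [slope_quotient]
    rests. *)
Lemma lam_rational P : ~ HF N P -> exists dx dy : nat, (0 < dy)%N /\ lam P * dy%:R = dx%:R.
Proof.
move=> nhP; have := lam_ge0 R nhP; rewrite le_eqVlt => /orP[/eqP e|l0].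
  by exists 0%N, 1%N; rewrite -e mul0r.
have /choice[hi hiP] : forall Q, exists h : R, ~ HF N Q -> is_limsup (excess Q) h.
  move=> Q; have [nhQ|h] := pselect (~ HF N Q); last by exists 0.
  by have [B /limsup_ex[h hP]] := excess_bound R nhQ; exists h.
have /choice[lo loP] : forall Q, exists h : R, ~ HF N Q -> is_limsup (fun n => - excess Q n) h.
  move=> Q; have [nhQ|h] := pselect (~ HF N Q); last by exists 0.
  have [B hB] := excess_bound R nhQ.
  by have [|h hP] := @limsup_ex R (fun n => - excess Q n) B; [move=> n; rewrite normrN | exists h].
have [//|Q nhQ _|Q nhQ _|Q nhQ _ _|dx [dy [_ /andP[dy0 _] e]]] :=
  @slope_cycle R N (lam P) hi (fun Q => - lo Q) [set: plane N]%SET P l0 nhP.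
- exact: hiP.
- by rewrite opprK; apply: loP.
- by rewrite finset.inE.
by exists dx, dy.
Qed.

Lemma alpha_HF P : HF N P -> alpha R P = 0%:E.
Proof. by move=> h; rewrite /alpha asboolT. Qed.

Lemma alpha_VF P : VF N P -> alpha R P = +oo%E.
Proof. by move=> h; rewrite /alpha (asboolF (proj1 h)) asboolT. Qed.

(** Existence combines the rationality of [lam P] with the belts; a different slope would leave the
    frontier at linearly growing distance. *)
Lemma alpha_SF P : SF N P -> exists a : rat,
  [/\ 0 < a, alpha R P = a%:E & ratr a = (lam P)^-1 :> R].
Proof.
move=> sf; have [nhP l0] := (SFP P).1 sf; have [_ nvP] := sf.
have [B BP] := excess_bound R nhP.
have uniq a : is_slope R P a -> ratr a = (lam P)^-1 :> R.
  move=> [a0 [b bP]]; have ra0 : 0 < ratr a :> R by rewrite ltr0q.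
  rewrite -[LHS]invrK; congr (_^-1); set t := (ratr a)^-1.
  have sq0 : 0 < Num.sqrt (1 + t ^+ 2) by rewrite sqrtr_gt0 ltr_pwDl // sqr_ge0.
  apply/eqP; rewrite -subr_eq0; apply: contraT => ne.
  have ne0 : 0 < `|t - lam P| by rewrite normr_gt0.
  have [j] := archi_lt (b * Num.sqrt (1 + t ^+ 2) + B) ne0.
  rewrite ltNge => /negP[]; have := bP j; rewrite dist_graph //= -/t normrM.
  rewrite (gtr0_norm (_ : 0 < (Num.sqrt _)^-1)) ?invr_gt0 // ler_pdivrMr // => h1.
  have -> : j%:R * `|t - lam P| = `|excess P j - ((fr P j)%:~R - t * j%:R)|.
    by rewrite -[j%:R in LHS]ger0_norm // -normrM /excess; congr (`|_|); ring.
  by apply: le_trans (ler_normB _ _) _; rewrite addrC lerD.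
have [dx [dy [dy0 e]]] := lam_rational nhP.
have dyR : 0 < dy%:R :> R by rewrite ltr0n.
have dx0 : (0 < dx)%N by rewrite -(ltr0n R) -e mulr_gt0.
have dxR : 0 < dx%:R :> R by rewrite ltr0n.
pose a0 : rat := dy%:R / dx%:R.
have ra0 : ratr a0 = (lam P)^-1 :> R.
  rewrite /a0 fmorph_div /= !ratr_nat -e invfM mulrCA divff ?mulr1 //; exact: lt0r_neq0.
have slope0 : is_slope R P a0.
  split; first by rewrite divr_gt0 ?ltr0n.
  have sq0 : 0 < Num.sqrt (1 + lam P ^+ 2) by rewrite sqrtr_gt0 ltr_pwDl // sqr_ge0.
  exists (B / Num.sqrt (1 + lam P ^+ 2)) => n; rewrite ra0 dist_graph ?invr_gt0 // invrK normrM.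
  rewrite (gtr0_norm (_ : 0 < (Num.sqrt _)^-1)) ?invr_gt0 // ler_pM2r ?invr_gt0 //.
  exact: BP.
have sl : is_slope R P (xget 0 [set a | is_slope R P a]).
  by apply: (xgetPex 0); exists a0.
exists (xget 0 [set a | is_slope R P a]); split; first by case: sl.
  by rewrite /alpha (asboolF nhP) (asboolF nvP).
exact: uniq.
Qed.

(** The ratio of horizontal displacement to Euclidean distance for the line of [P]. It depends on
    the slope only, so it does not affect comparisons among planes of one slope. *)
Definition norm_factor P : R := Num.sqrt (1 + lam P ^+ 2).

Lemma norm_factor_gt0 P : 0 < norm_factor P.
Proof. by rewrite sqrtr_gt0 ltr_pwDl // sqr_ge0. Qed.

Lemma dist_ell P n : ~ HF N P ->
  dist (frontier_point R P n) (ell R P) = excess P n / norm_factor P.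
Proof.
move=> nhP; have [v|sf] := (VF_or_SF P).2 nhP; rewrite /ell.
  have [_ l0] := (VFP P).1 v.
  rewrite (alpha_VF v) dist_vertical /norm_factor /excess l0 expr0n addr0 sqrtr1 divr1 //.
have [a [a0 -> e]] := alpha_SF sf; have [_ l0] := (SFP P).1 sf.
by rewrite e dist_graph ?invr_gt0 // invrK.
Qed.

Lemma maximumE (x0 M : R) (S : set R) : S M -> ubound S M -> maximum x0 S = M.
Proof.
move=> SM uM; apply: xget_unique => // y [Sy uy].
by apply/eqP; rewrite eq_le uy // uM.
Qed.

Lemma minimumE (x0 M : R) (S : set R) : S M -> lbound S M -> minimum x0 S = M.
Proof.
move=> SM uM; apply: xget_unique => // y [Sy uy].
by apply/eqP; rewrite eq_le uy // uM.
Qed.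

Definition hi P := maxd R P * norm_factor P.
Definition lo P := mind R P * norm_factor P.

(** Multiplied by a denominator of [lam P], the excess is a bounded integer sequence, which attains
    its upper and lower limits infinitely often. So the recurrent distances have a greatest and a
    least element. *)
Lemma excess_extremes P : ~ HF N P ->
  [/\ exists n0, forall n, (n0 <= n)%N -> lo P <= excess P n <= hi P,
      forall n0, exists2 n, (n0 <= n)%N & excess P n = hi P
    & forall n0, exists2 n, (n0 <= n)%N & excess P n = lo P].
Proof.
move=> nhP; have [B BP] := excess_bound R nhP.
have [dx [dy [dy0 e]]] := lam_rational nhP.
have dyR : 0 < dy%:R :> R by rewrite ltr0n.
pose z n : int := fr P n * dy%:Z - (dx * n)%N%:Z.
have zE n : excess P n = (z n)%:~R / dy%:R.
  rewrite /z rmorphB rmorphM /= -!pmulrn natrM -e /excess.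
  rewrite mulrBl mulfK ?gt_eqF //; congr (_ - _); rewrite (mulrAC _ dy%:R) mulfK ?gt_eqF //.
have zB n : `|z n| <= (Num.bound (B * dy%:R))%:Z.
  rewrite -(ler_int R) intr_norm; apply: ltW; apply: le_lt_trans (archi_boundP _).
    rewrite -ler_pdivrMr // -[X in _ / X]gtr0_norm // -normf_div -zE; exact: BP.
  by rewrite mulr_ge0 ?ler0n // (le_trans (normr_ge0 _) (BP 0%N)).
have [h [[n1 h1] h2]] := int_limsup zB.
have [|h' [[n2 h3] h4]] := @int_limsup (fun n => - z n) (Num.bound (B * dy%:R)).
  by move=> n; rewrite normrN.
have f0 := norm_factor_gt0 P.
pose H : R := h%:~R / dy%:R; pose L : R := (- h')%:~R / dy%:R.
have ev n : (maxn n1 n2 <= n)%N -> L <= excess P n <= H.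
  rewrite geq_max zE => /andP[le1 le2]; rewrite !ler_pM2r ?invr_gt0 // !ler_int h1 // andbT.
  by have := h3 n le2; lia.
have hiE n0 : exists2 n, (n0 <= n)%N & excess P n = H.
  by have [n le ez] := h2 n0; exists n => //; rewrite zE ez.
have loE n0 : exists2 n, (n0 <= n)%N & excess P n = L.
  by have [n le ez] := h4 n0; exists n => //; rewrite zE /L -ez opprK.
have rec r : recurrent_dists R P r <-> forall n0, exists2 n, (n0 <= n)%N & r = excess P n / norm_factor P.
  rewrite /recurrent_dists /=; split=> [/infinite_natP h0 n0|h0].
    by have [n le /= ->] := h0 n0; exists n => //; rewrite dist_ell.
  by apply/infinite_natP => n0; have [n le ->] := h0 n0; exists n => //=; rewrite dist_ell.
have hiH : hi P = H.
  rewrite /hi /maxd (asboolF nhP) (@maximumE _ (H / norm_factor P)) ?divfK ?gt_eqF //.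
    by apply/rec => n0; have [n le <-] := hiE n0; exists n.
  move=> r /rec /(_ (maxn n1 n2))[n le ->]; rewrite ler_pM2r ?invr_gt0 //.
  by have /andP[] := ev n le.
have loL : lo P = L.
  rewrite /lo /mind (asboolF nhP) (@minimumE _ (L / norm_factor P)) ?divfK ?gt_eqF //.
    by apply/rec => n0; have [n le <-] := loE n0; exists n.
  move=> r /rec /(_ (maxn n1 n2))[n le ->]; rewrite ler_pM2r ?invr_gt0 //.
  by have /andP[] := ev n le.
by rewrite hiH loL; split=> //; exists (maxn n1 n2).
Qed.

End Planes.

(** * Black and white regions *)

Section Regions.
Variables (R : realType) (N : ocn).
Implicit Types (P Q : plane N) (m d : int) (n : nat) (t : R).

Local Notation lam := (@lam R N).
Local Notation excess := (@excess R N).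
Local Notation hi := (@hi R N).
Local Notation lo := (@lo R N).

Lemma absz_natr (n : int) : 0 <= n -> ((absz n)%:R : R) = n%:~R.
Proof. by move=> n0; rewrite -[LHS]/((absz n)%:Z%:~R) gez0_abs. Qed.

Lemma extremes_uniform : exists n0, forall P n, (n0 <= n)%N -> ~ HF N P ->
  lo P <= excess P n <= hi P.
Proof.
have /choice[f fP] : forall P, exists n0, forall n, (n0 <= n)%N -> ~ HF N P -> lo P <= excess P n <= hi P.
  move=> P; have [hP|nhP] := pselect (HF N P); first by exists 0%N => n _ [].
  by have [[n0 h] _ _] := excess_extremes R nhP; exists n0 => n le _; apply: h.
by exists (\max_P f P)%N => P n le; apply: fP; apply: leq_trans le; apply: leq_bigmax.
Qed.

(** Induction on the number of steeper planes, with the exact potentials [lo Q + 1]. [cnt] is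
    abstract because it is instantiated both by numbers of classes and by numbers of planes. *)
Lemma white_region (cnt : plane N -> R) :
  (forall P, ~ HF N P -> 0 <= cnt P) ->
  (forall P Q, ~ HF N P -> ~ HF N Q -> lam Q < lam P \/ lam Q = lam P /\ lo Q < lo P ->
     cnt Q <= cnt P - 1) ->
  forall P m (n : int), ~ HF N P -> 0 <= m ->
    cnt P * (1 + lam P) < offset 1 (lam P) m n -> ~ blackz P m n.
Proof.
move=> cnt0 ord P; have [t] := ubnP #|[pred Q | lam Q < lam P]|.
elim: t P => // t IH P; rewrite ltnS => tP m n nhP m0 hx.
set l := lam P in hx *; have l0 : 0 <= l := lam_ge0 R nhP.
pose c Q := ~ HF N Q /\ lam Q = l; pose S Q := ~ HF N Q /\ lam Q < l.
have [n1 n1P] := extremes_uniform.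
have [B BP] : exists B : R, forall Q t, B <= t -> lo Q + 1 <= t.
  by apply: finite_bound => Q; exists (lo Q + 1).
have [n2 n2P] := @flatter_far R N l B.
apply: (@white_certificate R N 1 l c S cnt) => //.
- by move=> Q [nhQ _]; apply: cnt0.
- move=> Q P0 i k [nhQ ltQ] [nhP0 eP0] i0 k0 h; apply: IH => //.
    apply: leq_trans tP; apply: proper_card; apply/properP; split.
      by apply/fintype.subsetP => q; rewrite !inE => /lt_trans; apply.
    by exists Q; rewrite !inE ?ltxx.
  have := ord P0 Q nhP0 nhQ ltac:(by left; rewrite eP0).
  have := cnt0 Q nhQ; have := lam_ge0 R nhQ; rewrite -(ler0z R) in k0.
  move: h ltQ; rewrite !offset1 => h1 h2 h3 h4 h5.
  (* On nonnegative rows the line of the steeper plane [Q] lies further left, and its strips are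
     narrower. *)
  have h6 : lam Q * k%:~R <= l * k%:~R by rewrite ler_wpM2r // ltW.
  have h7 : cnt Q * (1 + lam Q) <= (cnt P0 - 1) * (1 + l).
    by apply: ler_pM => //; lra.
  lra.
- move=> j; exists (fun Q => lo Q + 1), (maxn n1 n2); split.
  + move=> Q [nhQ eQ]; have [_ _ /(_ (maxn n1 n2 + j)%N)[i le ei]] := excess_extremes R nhQ.
    have f_ge := fr_ge i nhQ; exists (fr Q i + 1), i; split.
    * by apply: gt_fr_white => //=; clear -f_ge; lia.
    * by clear -f_ge; lia.
    * by clear -le; lia.
    * have inv0 : 0 <= (j.+1%:R : R)^-1 by rewrite invr_ge0.
      rewrite offset1 rmorphD /=; rewrite /excess eQ in ei.
      change (1%:~R : R) with (1 : R); change (i%:~R : R) with (i%:R : R).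
      by move: (_^-1) inv0 => inv inv0; lra.
  + move=> Q P0 i k cP0 nSQ i0 kge w; have k0 : 0 <= k by clear -kge; lia.
    have [cQ|ncQ] := pselect (c Q); [left | right]; split=> //.
      have [nhQ eQ] := cQ; have := n1P Q (absz k) ltac:(by clear -kge; lia) nhQ.
      move=> /andP[h1 _]; have := white_gt_fr nhQ i0 k0 w; rewrite -(ler_int R) rmorphD /= => h2.
      rewrite /excess eQ absz_natr // in h1; rewrite offset1.
      by change (1%:~R : R) with (1 : R) in h2; lra.
    apply: le_trans (BP P0 B (lexx _)) _; apply: (n2P Q) => //; first by clear -kge; lia.
    move=> [nhQ leQ]; have [eQ|ne] := eqVneq (lam Q) l; first by apply: ncQ.
    by apply: nSQ; split=> //; rewrite lt_neqAle ne.
  + move=> Q Q' [nhQ eQ] [nhQ' eQ'] lt; apply: ord => //; right; split; first by rewrite eQ eQ'.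
    by lra.
Qed.

Definition hmin P : nat := minimum 0%N [set n | frontier P n = +oo%E].

Lemma hminP P : HF N P -> frontier P (hmin P) = +oo%E /\
  forall n, frontier P n = +oo%E -> (hmin P <= n)%N.
Proof.
move=> [n0 h0]; have ex : exists n, `[< frontier P n = +oo%E >] by exists n0; apply/asboolP.
have [i /asboolP hi mini] := ex_minnP ex.
have : ([set n | frontier P n = +oo%E] `&` lbound [set n | frontier P n = +oo%E]) (hmin P).
  by apply: (xgetPex 0%N); exists i; split=> // j hj; apply: mini; apply/asboolP.
by move=> [h1 h2]; split=> // n hn; apply: (h2 n).
Qed.

(** The potential is minus the least fully black row. A reply good for unboundedly many columns of
    that row leads to a fully black row of the next plane, so potentials are followed without
    error. *)
Lemma HF_region (cnt : plane N -> R) :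
  (forall P, HF N P -> 0 <= cnt P) ->
  (forall P Q, HF N P -> HF N Q -> (hmin Q < hmin P)%N -> cnt Q <= cnt P - 1) ->
  forall P m (n : int), HF N P -> 0 <= m -> cnt P < n%:~R -> blackz P m n.
Proof.
move=> cnt0 ord P m n hP m0 hx k.
apply: (@black_certificate R N 0 1 0 (HF N) (fun Q => - (hmin Q)%:R) cnt) => //.
- by move=> Q Q' hQ hQ' lt; apply: ord => //; rewrite ltrN2 ltr_nat in lt.
- move=> Q a d p' hQ r; have /frontier_infty b := (hminP hQ).1.
  have [||d' [q' [r' h]]] := @reply_pigeonhole N Q.2 a
    (fun d' q' j => blackz (p', q') (j.+1%:Z + d) ((hmin Q)%:Z + d')).
  + by move=> d' q' i j ij; apply: blackz_mono => //; lia.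
  + by move=> j; apply: (blackz_step (b j.+1%:Z) r); have := effect_bound r; lia.
  exists d', q'; split=> // Q'; left.
  have n0 := blackz_ge0 (h 0%N); pose i : nat := absz ((hmin Q)%:Z + d').
  have iE : i%:Z = (hmin Q)%:Z + d' by rewrite /i; clear -n0; lia.
  have fQ' : frontier Q' i = +oo%E.
    apply/frontier_infty => m'; rewrite iE; apply: blackz_mono (h (absz m')) => //.
    by have := effect_bound r; lia.
  have hQ' : HF N Q' by exists i.
  split=> //; have le := (hminP hQ').2 i fQ'.
  rewrite /offset mul0r mul1r subr0 sub0r -opprD lerN2.
  have -> : ((hmin Q)%:R + d'%:~R : R) = i%:R by rewrite -[i%:R]/(i%:Z%:~R) iE rmorphD.
  by rewrite ler_nat.
- by rewrite /offset; lra.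
Qed.

(** The potential is [hi]. One reply is chosen that works at arbitrarily high frontier points
    attaining [hi Q], which makes the inequality between recurrent extrema exact. Escapes to [HF]
    planes are settled by [HF_region], those to flatter planes by induction. *)
Lemma black_region (cnt : plane N -> R) :
  (forall P, HF N P \/ SF N P -> 0 <= cnt P) ->
  (forall P Q, HF N P -> HF N Q -> (hmin Q < hmin P)%N -> cnt Q <= cnt P - 1) ->
  (forall P Q, SF N P -> HF N Q -> cnt Q <= cnt P - 1) ->
  (forall P Q, SF N P -> SF N Q -> lam P < lam Q \/ lam Q = lam P /\ hi P < hi Q ->
     cnt Q <= cnt P - 1) ->
  forall P m (n : int), SF N P -> 0 <= m ->
    offset 1 (lam P) m n < - (cnt P * (1 + lam P)) -> blackz P m n.
Proof.
move=> cnt0 ordHH ordSH ordSS P; have [t] := ubnP #|[pred Q | lam P < lam Q]|.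
elim: t P => // t IH P; rewrite ltnS => tP m n sP m0 hx k.
have [nhP l0] := (SFP R P).1 sP; set l := lam P in l0 hx.
pose c Q := ~ HF N Q /\ lam Q = l.
have cSF Q : c Q -> SF N Q by move=> [nhQ eQ]; apply/(SFP R); rewrite eQ.
have [n1 n1P] := extremes_uniform.
apply: (@black_certificate R N 1 l 0 c hi cnt) => //; rewrite ?ltW //; last by rewrite mulr0 subr0.
- by move=> Q /cSF sQ; apply: cnt0; right.
- by move=> Q Q' cQ cQ' lt; apply: ordSS; [exact: cSF | exact: cSF | right; rewrite (proj2 cQ) (proj2 cQ')].
move=> Q a d p' cQ r; have [nhQ eQ] := cQ; have bd := effect_bound r.
have [j0 j0P] := archi_lt (1 - hi Q) l0.
have [||d' [q' [r' h]]] := @reply_pigeonhole N Q.2 a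
  (fun d' q' j => exists n, [/\ (j <= n)%N, excess Q n = hi Q, 0 < fr Q n &
     blackz (p', q') (fr Q n + d) (n%:Z + d')]).
- by move=> d' q' i j ij [n' [le e f b]]; exists n'; split=> //; apply: leq_trans le.
- move=> j; have [_ /(_ (maxn j j0))[i le ei] _] := excess_extremes R nhQ.
  have fpos : 0 < fr Q i.
    rewrite -(ltr_int R); rewrite /excess eQ in ei.
    have : j0%:R * l <= i%:R * l by rewrite ler_pM2r // ler_nat; clear -le; lia.
    by change (0%:~R : R) with (0 : R); lra.
  have [|d' [q' [r' b]]] := blackz_step (proj2 (blackz_fr i nhQ (ltW fpos)) (lexx _)) r.
    by clear -fpos bd; lia.
  by exists d', q'; split=> //; exists i; split=> //; clear -le; lia.
exists d', q'; split=> // Q'; have bd' := effect_bound r'.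
have /andP[v1 v2] := @offset_effect R 1 l d d' ler01 (ltW l0) bd bd'.
have excE i : excess Q i = hi Q -> offset 1 l (fr Q i + d) (i%:Z + d') = hi Q + offset 1 l d d'.
  by move=> ei; rewrite offsetD -ei /excess eQ offset1.
have [cQ'|ncQ'] := pselect (c Q'); [left | right]; split=> //.
  have [nhQ' eQ'] := cQ'; have [i [le ei fi b]] := h n1.+1.
  have m0' : 0 <= fr Q i + d by clear -fi bd; lia.
  have n0' := blackz_ge0 b; have := blackz_fr_le nhQ' m0' n0' b.
  pose i' : nat := absz (i%:Z + d').
  have := n1P Q' i' ltac:(by rewrite /i'; clear -le bd'; lia) nhQ'.
  rewrite /excess eQ' absz_natr // => /andP[_ h1]; rewrite -(ler_int R) -/i' => h2.
  by have := excE i ei; rewrite offset1; lra.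
move=> P0 m' n' cP0 m0' n0' hoff.
have sP0 := cSF _ cP0.
rewrite offset1 in hoff; rewrite -(ler0z R) in m0'; rewrite -(ler0z R) in n0'.
have [hQ'|nhQ'] := pselect (HF N Q').
  have le := ordSH P0 Q' sP0 hQ'.
  apply: (HF_region (cnt := cnt)) => //.
  - by move=> q hq; apply: cnt0; left.
  - by rewrite -(ler0z R).
  apply: le_lt_trans le _; rewrite -(ltr_pM2l l0).
  have := cnt0 Q' (or_introl hQ'); have := ordSH P0 Q' sP0 hQ'; lra.
(* Steeper planes cannot occur: their high black points are far to the left, while the copied reply
   ends near the line. *)
have [ltQ'|geQ'] := ltP l (lam Q'); last first.
  have [n2 n2P] := @steeper_far R N l (2 + l - hi Q).
  have [i [le ei fi b]] := h n2.+1.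
  have ltQ' : lam Q' < l.
    by rewrite lt_neqAle geQ' andbT; apply/eqP => e; apply: ncQ'.
  have := n2P Q' _ _ _ _ nhQ' ltQ' b.
  move=> /(_ ltac:(by clear -fi bd; lia) ltac:(by clear -le bd'; lia)).
  by rewrite excE //; lra.
have sQ' : SF N Q' by apply/(SFP R); split=> //; apply: lt_trans ltQ'.
have le : cnt Q' <= cnt P0 - 1 by apply: ordSS => //; left; rewrite (proj2 cP0).
have c0 := cnt0 Q' (or_intror sQ').
apply: IH => //; last 2 first.
- by rewrite -(ler0z R).
- rewrite offset1; set k1 := cnt P0 - 1 in le hoff.
  (* In the form [m' + k1 < l * (n' - k1)] the condition persists for larger inverse slopes, as
     [n' - k1] is positive. *)
  have nk : k1 < n'%:~R by rewrite -(ltr_pM2l l0); lra.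
  have h1 : l * (n'%:~R - k1) <= lam Q' * (n'%:~R - k1) by rewrite ler_pM2r ?subr_gt0 // ltW.
  have h2 : lam Q' * cnt Q' <= lam Q' * k1 by rewrite ler_pM2l //; apply: lt_trans ltQ'.
  by lra.
apply: leq_trans tP; apply: proper_card; apply/properP; split.
  by apply/fintype.subsetP => q; rewrite !inE; apply: lt_trans.
by exists Q'; rewrite !inE ?ltxx.
Qed.

End Regions.

(** * Counting classes *)

Section Classes.
Variables (T : finType) (r : rel T).
Hypotheses (r_refl : reflexive r) (r_trans : transitive r).

Let e : rel T := fun x y => r x y && r y x.
Let cls x : {set T} := finset (e x).

(** Blocks of a partition of [A] are cut off at [A]; whole classes make the counts for different
    prefixes comparable. *)
Lemma card_classes (A : {set T}) : #|equivalence_partition e A| = #|[set cls x | x in A]%SET|.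
Proof.
have -> : equivalence_partition e A = [set A :&: B | B in [set cls x | x in A]]%SET.
  rewrite -imset_comp; apply: eq_in_imset => x _ /=.
  by apply/setP => y; rewrite !finset.inE.
apply: card_in_imset => _ _ /imsetP[x xA ->] /imsetP[y yA ->] /setP h.
have := h x; rewrite !finset.inE xA /e r_refl /= => /esym/andP[yx xy].
apply/setP => z; rewrite !finset.inE /e; apply/andP/andP => -[h1 h2].
  by split; [apply: r_trans h1 | apply: r_trans xy].
by split; [apply: r_trans h1 | apply: r_trans yx].
Qed.

Lemma nclasses_gt0 (s : seq T) i : (i < size s)%N -> (0 < nclasses e s i.+1)%N.
Proof.
case: s => // x s _; rewrite /nclasses card_classes card_gt0; apply/set0Pn; exists (cls x).
by apply: imset_f; rewrite finset.inE /= mem_head.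
Qed.

(** By sortedness no entry up to [i] is equivalent to the one at [j], whose class is therefore
    new. *)
Lemma nclasses_lt x0 (s : seq T) i j : sorted r s -> (i < size s)%N -> (j < size s)%N ->
  ~~ r (nth x0 s j) (nth x0 s i) -> (nclasses e s i.+1 < nclasses e s j.+1)%N.
Proof.
move=> srt si sj nr; have mono := sorted_leq_nth r_trans r_refl x0 srt.
have ij : (i < j)%N by rewrite ltnNge; apply/negP => ji; case/negP: nr; apply: mono.
rewrite /nclasses !card_classes; apply: proper_card; apply/properP; split.
  apply: imsetS; apply/fintype.subsetP => x; rewrite !finset.inE.
  by rewrite -(subnKC (leqW ij)) takeD mem_cat => ->.
exists (cls (nth x0 s j)).
  apply: imset_f; rewrite finset.inE; have sz : size (take j.+1 s) = j.+1 by rewrite size_takel.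
  by rewrite -(nth_take x0 (ltnSn j)); apply: mem_nth; rewrite sz.
apply/imsetP => -[x]; rewrite finset.inE => /(nthP x0)[k]; rewrite size_takel // => ki.
rewrite nth_take // => <- /setP /(_ (nth x0 s k)).
rewrite !finset.inE /e !r_refl /= => /andP[h _]; case/negP: nr; apply: r_trans h _.
by apply: mono; rewrite ?inE //; exact: leq_ltn_trans (_ : k <= i)%N si.
Qed.

End Classes.

(** * The two preorders in terms of [lam], [hi] and [lo] *)

Lemma eq_of_ltE d d' (T : orderType d) (T' : orderType d') (x y : T) (a b : T') :
  (x < y)%O = (b < a)%O -> (y < x)%O = (a < b)%O -> (x == y) = (a == b).
Proof.
move=> h1 h2; apply/eqP/eqP => e; apply/eqP; rewrite eq_le !leNgt.
  by rewrite -h1 -h2 e ltxx.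
by rewrite h1 h2 e ltxx.
Qed.

Lemma ler_of_scaled (F : numFieldType) (f x y a b : F) :
  0 < f -> x * f = a -> y * f = b -> a <= b -> x <= y.
Proof. by move=> f0 <- <-; rewrite ler_pM2r. Qed.

Section Orders.
Variables (R : realType) (N : ocn).
Implicit Types (P Q : plane N) (m d : int) (n : nat) (t : R).

Local Notation lam := (@lam R N).
Local Notation hi := (@hi R N).
Local Notation lo := (@lo R N).
Local Notation leL := (@leL R N).
Local Notation leR := (@leR R N).

Lemma maxd_HF P : HF N P -> maxd R P = - (hmin P)%:R.
Proof. by move=> hP; rewrite /maxd asboolT. Qed.

Lemma leL_refl : reflexive leL.
Proof. by move=> P; rewrite /leL eqxx lexx orbT. Qed.

Lemma leL_trans : transitive leL.
Proof.
move=> Q P P'; rewrite /leL => /orP[h1|/andP[/eqP e1 h1]] /orP[h2|/andP[/eqP e2 h2]].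
- by rewrite (lt_trans h2 h1).
- by rewrite -e2 h1.
- by rewrite e1 h2.
- by rewrite e1 e2 eqxx (le_trans h1 h2) orbT.
Qed.

Lemma leR_refl : reflexive leR.
Proof. by move=> P; rewrite /leR eqxx lexx orbT. Qed.

Lemma leR_trans : transitive leR.
Proof.
move=> Q P P'; rewrite /leR => /orP[h1|/andP[/eqP e1 h1]] /orP[h2|/andP[/eqP e2 h2]].
- by rewrite (lt_trans h1 h2).
- by rewrite -e2 h1.
- by rewrite e1 h2.
- by rewrite e1 e2 eqxx (le_trans h2 h1) orbT.
Qed.

Lemma alpha_lt P Q : ~ HF N P -> ~ HF N Q -> (alpha R P < alpha R Q)%E = (lam Q < lam P).
Proof.
move=> nhP nhQ; have [vP|sP] := (VF_or_SF R P).2 nhP; have [vQ|sQ] := (VF_or_SF R Q).2 nhQ.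
- by rewrite !alpha_VF // (proj2 ((VFP R P).1 vP)) (proj2 ((VFP R Q).1 vQ)) !ltxx.
- have [a [a0 -> _]] := alpha_SF R sQ; have [_ l0] := (SFP R Q).1 sQ.
  by rewrite alpha_VF // (proj2 ((VFP R P).1 vP)) (lt_gtF l0).
- have [a [a0 -> _]] := alpha_SF R sP; have [_ l0] := (SFP R P).1 sP.
  by rewrite alpha_VF // (proj2 ((VFP R Q).1 vQ)) l0 ltry.
have [a [a0 -> ea]] := alpha_SF R sP; have [_ lP] := (SFP R P).1 sP.
have [b [b0 -> eb]] := alpha_SF R sQ; have [_ lQ] := (SFP R Q).1 sQ.
by rewrite lte_fin -(ltr_rat R) ea eb ltf_pV2 // posrE.
Qed.

Lemma alpha_eq P Q : ~ HF N P -> ~ HF N Q -> (alpha R P == alpha R Q) = (lam P == lam Q).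
Proof.
by move=> nhP nhQ; apply: eq_of_ltE; apply: alpha_lt.
Qed.

Lemma alpha_HF_SF P Q : HF N P -> SF N Q -> (alpha R P < alpha R Q)%E.
Proof. by move=> hP sQ; rewrite alpha_HF //; have [a [a0 -> _]] := alpha_SF R sQ; rewrite lte_fin. Qed.

Lemma not_leL P Q : ~ HF N P -> ~ HF N Q -> lam Q < lam P \/ lam Q = lam P /\ lo Q < lo P ->
  ~~ leL P Q.
Proof.
move=> nhP nhQ h; rewrite /leL alpha_lt // alpha_eq //; case: h => [lt|[e lt]].
  by rewrite negb_or -leNgt (ltW lt) /= gt_eqF.
rewrite e ltxx eqxx /= -ltNge; move: lt; rewrite /lo /norm_factor e ltr_pM2r //.
by have := norm_factor_gt0 R P.
Qed.

Lemma not_leR_SF P Q : SF N P -> SF N Q -> lam P < lam Q \/ lam Q = lam P /\ hi P < hi Q ->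
  ~~ leR P Q.
Proof.
move=> [nhP _] [nhQ _] h; rewrite /leR alpha_lt // alpha_eq //; case: h => [lt|[e lt]].
  by rewrite negb_or -leNgt (ltW lt) /= lt_eqF.
rewrite e ltxx eqxx /= -ltNge; move: lt; rewrite /hi /norm_factor e ltr_pM2r //.
by have := norm_factor_gt0 R P.
Qed.

Lemma not_leR_HF P Q : HF N P -> HF N Q -> (hmin Q < hmin P)%N -> ~~ leR P Q.
Proof.
move=> hP hQ lt; rewrite /leR !alpha_HF // ltxx eqxx /= -ltNge !maxd_HF //.
by rewrite ltrN2 ltr_nat.
Qed.

Lemma not_leR_HF_SF P Q : SF N P -> HF N Q -> ~~ leR P Q.
Proof.
move=> sP hQ; rewrite /leR; have h := alpha_HF_SF hQ sP.
by rewrite negb_or -leNgt (ltW h) gt_eqF.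
Qed.

(** [slope_cycle] with the exact extrema: planes of one slope share [norm_factor], so maximal
    [hi - lo] means maximal [spand]. *)
Lemma slope_quotient P : SF N P ->
  exists dx dy : nat, [/\ (1 <= dx <= #|planes_ms R N (alpha R P)|)%N,
    (1 <= dy <= #|planes_ms R N (alpha R P)|)%N & lam P * dy%:R = dx%:R].
Proof.
move=> sP; have [nhP l0] := (SFP R P).1 sP; have [a [a0 ea _]] := alpha_SF R sP.
apply: (@slope_cycle R N (lam P) hi lo _ P l0 nhP erefl) => [Q nhQ _|Q nhQ _|Q nhQ eQ maxQ].
- move=> e e0; have [[n0 h1] h2 _] := excess_extremes R nhQ; split.
    by exists n0 => n /h1 /andP[_ h]; apply: le_trans h _; rewrite lerDl ltW.
  by move=> n1; have [n le ei] := h2 n1; exists n => //; rewrite ei lerBlDr lerDl ltW.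
- move=> e e0; have [[n0 h1] _ h2] := excess_extremes R nhQ; split.
    by exists n0 => n /h1 /andP[h _]; rewrite lerNl opprD opprK; lra.
  by move=> n1; have [n le ei] := h2 n1; exists n => //; rewrite ei; lra.
have aQ : alpha R Q = alpha R P by apply/eqP; rewrite alpha_eq // eQ.
rewrite /planes_ms finset.inE; apply/andP; split.
  by rewrite finset.inE; apply/eqP; exact: aQ.
apply/forall_inP => P'; rewrite finset.inE => /eqP aP'.
have nhP' : ~ HF N P' by move=> /(alpha_HF R); rewrite aP' ea => -[]; apply/eqP; rewrite gt_eqF.
have eP' : lam P' = lam Q by apply/eqP; rewrite -(alpha_eq nhP' nhQ) aP' aQ.
have f0 := norm_factor_gt0 R Q.
have fe : norm_factor R P' = norm_factor R Q by rewrite /norm_factor eP'.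
have s1 : spand R P' * norm_factor R Q = hi P' - lo P' by rewrite -fe /spand mulrBl.
have s2 : spand R Q * norm_factor R Q = hi Q - lo Q by rewrite /spand mulrBl.
exact: (ler_of_scaled f0 s1 s2 (maxQ P' nhP' (etrans eP' eQ))).
Qed.

Lemma alpha_quotient P (dx dy : nat) : SF N P -> (0 < dx)%N -> lam P * dy%:R = dx%:R ->
  alpha R P = (dy%:R / dx%:R : rat)%:E.
Proof.
move=> sP dx0 e; have [a [a0 -> ea]] := alpha_SF R sP; have [_ l0] := (SFP R P).1 sP.
congr (_%:E); apply: (fmorph_inj (@ratr R)); rewrite [LHS]ea fmorph_div /= !ratr_nat -e.
have dy0 : (dy%:R : R) != 0.
  by apply/eqP => d0; move: dx0; rewrite -(ltr0n R) -e d0 mulr0 ltxx.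
by rewrite invfM mulrCA divff // mulr1.
Qed.

(** The strips have width [1 + lam P], and the neighbourhood of index [k] begins after [k - 1] of
    them; hence [cnt] is the class number minus one. *)
Lemma rnb_white (s : seq (plane N)) P : (forall Q, Q \in s <-> ~ HF N Q) -> sorted leL s -> P \in s ->
  rnb (nclasses (@eqvL R N) s (index P s).+1) (ell R P) `<=` white P.
Proof.
move=> memP srt Ps [m n] h /(blackE P (m, n)) /=.
pose cl Q := nclasses (@eqvL R N) s (index Q s).+1.
pose cnt Q : R := (cl Q)%:R - 1.
have cl_gt0 Q : ~ HF N Q -> (0 < cl Q)%N.
  by move=> /memP Qs; apply: (nclasses_gt0 leL_refl leL_trans); rewrite index_mem.
have nhP := (memP P).1 Ps.
apply: (@white_region R N cnt) => //.
- by move=> Q nhQ; rewrite subr_ge0 ler1n; apply: cl_gt0.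
- move=> Q Q' nhQ nhQ' lt; rewrite lerD2r lerBrDr natr1 ler_nat.
  have [Qs Qs'] := ((memP Q).2 nhQ, (memP Q').2 nhQ').
  have lt_cl := @nclasses_lt _ leL leL_refl leL_trans P s (index Q' s) (index Q s) srt.
  rewrite !index_mem !nth_index // in lt_cl; exact: (lt_cl Qs' Qs (not_leL nhQ nhQ' lt)).
rewrite offset1; move: h; rewrite /rnb /= /ell /cnt -/(cl P).
have [v|sP] := (VF_or_SF R P).2 nhP.
  by rewrite alpha_VF // (proj2 ((VFP R P).1 v)) /= => /andP[h _]; change (m%:~R : R) with (m%:R : R); lra.
have [a [a0 -> ea]] := alpha_SF R sP.
rewrite /= subr0 /step div1r ea => /andP[h _].
change (m%:~R : R) with (m%:R : R); change (n%:~R : R) with (n%:R : R); lra.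
Qed.

Lemma lnb_black (s : seq (plane N)) P : (forall Q, Q \in s <-> HF N Q \/ SF N Q) -> sorted leR s -> P \in s ->
  lnb (nclasses (@eqvR R N) s (index P s).+1) (ell R P) `<=` black P.
Proof.
move=> memP srt Ps [m n] h; apply/(blackE P (m, n)) => /=.
pose cl Q := nclasses (@eqvR R N) s (index Q s).+1.
pose cnt Q : R := (cl Q)%:R - 1.
have cnt0 Q : HF N Q \/ SF N Q -> 0 <= cnt Q.
  move=> /memP Qs; rewrite subr_ge0 ler1n.
  by apply: (nclasses_gt0 leR_refl leR_trans); rewrite index_mem.
have lt_cnt Q Q' : HF N Q \/ SF N Q -> HF N Q' \/ SF N Q' -> ~~ leR Q Q' -> cnt Q' <= cnt Q - 1.
  move=> /memP Qs /memP Qs' nle; rewrite lerD2r lerBrDr natr1 ler_nat.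
  have lt_cl := @nclasses_lt _ leR leR_refl leR_trans P s (index Q' s) (index Q s) srt.
  rewrite !index_mem !nth_index // in lt_cl; exact: (lt_cl Qs' Qs nle).
have ordHH Q Q' : HF N Q -> HF N Q' -> (hmin Q' < hmin Q)%N -> cnt Q' <= cnt Q - 1.
  by move=> h1 h2 lt; apply: lt_cnt; [left | left | apply: not_leR_HF].
move: h; rewrite /lnb /ell -/(cl P); have [hP|sP] := (memP P).1 Ps.
  rewrite alpha_HF // rmorph0 eqxx /= add0r => /andP[h _].
  by apply: (@HF_region R N cnt) => // Q hQ; apply: cnt0; left.
have [a [a0 -> ea]] := alpha_SF R sP.
rewrite gt_eqF ?ltr0q //= subr0 /step div1r ea => /andP[_ h].
apply: (@black_region R N cnt) => //.
- by move=> Q Q' h1 h2; apply: lt_cnt; [right | left | apply: not_leR_HF_SF].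
- by move=> Q Q' h1 h2 lt; apply: lt_cnt; [right | right | apply: not_leR_SF].
rewrite offset1 /cnt.
change (m%:~R : R) with (m%:R : R); change (n%:~R : R) with (n%:R : R); lra.
Qed.

End Orders.

(** * Polynomial bounds *)

Lemma missed_value (T : finType) (f : T -> int) (b : int) :
  exists t, b <= t <= b + #|T|%:Z /\ forall x, f x <> t.
Proof.
apply: contrapT => nex.
have /choice[g gP] : forall i : 'I_#|T|.+1, exists x, f x = b + i%:Z.
  move=> i; apply: contrapT => h; apply: nex; exists (b + i%:Z); split.
    by have := ltn_ord i; lia.
  by move=> x e; apply: h; exists x.
have ginj : injective g.
  by move=> i j e; apply: val_inj; have := gP i; rewrite e gP /=; lia.
have := leq_card g ginj; rewrite card_ord; lia.
Qed.

Section PolynomialBounds.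
Variables (R : realType) (N : ocn).
Implicit Types (P Q : plane N) (m d : int) (n : nat) (t : R).

Local Notation lam := (@lam R N).
Local Notation hi := (@hi R N).
Local Notation lo := (@lo R N).
Local Notation K := #|plane N|.

Lemma SF_lam_bounds P : SF N P -> lam P <= K%:R /\ 1 <= K%:R * lam P.
Proof.
move=> sP; have [dx [dy [/andP[x1 xK] /andP[y1 yK] e]]] := slope_quotient R sP.
have y0 : 1 <= dy%:R :> R by rewrite ler1n.
have x0 : 1 <= dx%:R :> R by rewrite ler1n.
have xK' : dx%:R <= K%:R :> R by rewrite ler_nat (leq_trans xK) // max_card.
have yK' : dy%:R <= K%:R :> R by rewrite ler_nat (leq_trans yK) // max_card.
have [_ l0] := (SFP R P).1 sP.
split; first by apply: le_trans xK'; rewrite -e ler_peMr // ltW.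
by apply: le_trans x0 _; rewrite -e mulrC; apply: ler_wpM2r => //; apply: ltW.
Qed.

(** A form of [white_region] free of slopes: [cnt] counts the planes strictly before [P], so it is
    at most [K], and so is [lam P] for [P] in [SF]. *)
Lemma white_bound P m (n : int) : ~ HF N P -> 0 <= m -> 0 <= n ->
  (if `[< VF N P >] then K%:Z < m else K%:Z * n + K%:Z * (K%:Z + 1) < m) -> ~ blackz P m n.
Proof.
move=> nhP m0 n0 hm.
pose rel P Q := [&& ~~ `[< HF N Q >] & (lam Q < lam P) || (lam Q == lam P) && (lo Q < lo P)].
pose cnt P : R := #|rel P|%:R.
apply: (@white_region R N cnt) => //.
  move=> Q Q' nhQ nhQ' h; rewrite lerBrDr natr1 ler_nat; apply: proper_card; apply/properP; split.
    apply/fintype.subsetP => q; rewrite !unfold_in /rel => /andP[-> /=].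
    case: h => [lt|[-> lt]]; move=> /orP[h1|/andP[/eqP e h1]].
    - by rewrite (lt_trans h1 lt).
    - by rewrite e lt.
    - by rewrite h1.
    - by rewrite e eqxx (lt_trans h1 lt) orbT.
  exists Q'; rewrite unfold_in /rel; last by rewrite !ltxx !andbF.
  by rewrite (asboolF nhQ') //=; case: h => [->//|[-> ->]]; rewrite eqxx orbT.
have cK : cnt P <= K%:R by rewrite ler_nat max_card.
have c0 : 0 <= cnt P by [].
rewrite offset1; move: hm; case: asboolP => [v|nv]; rewrite -(ltr_int R).
  rewrite (proj2 ((VFP R P).1 v)) -pmulrn; lra.
have sP : SF N P by [].
have [lK _] := SF_lam_bounds sP; have [_ l0] := (SFP R P).1 sP.
rewrite rmorphD !rmorphM /= rmorphD /= -!pmulrn => h; rewrite -(ler0z R) in n0.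
have h1 : lam P * n%:~R <= K%:R * n%:~R by rewrite ler_wpM2r.
have h2 : cnt P * (1 + lam P) <= K%:R * (1 + K%:R) by apply: ler_pM => //; lra.
change (1%:~R : R) with (1 : R) in h; lra.
Qed.

(** Dual to [white_bound]; dividing by the inverse slope costs a factor [K], since [1 <= K * lam P]
    on [SF]. *)
Lemma black_bound P m (n : int) : ~ VF N P -> 0 <= m ->
  (if `[< HF N P >] then K%:Z < n else K%:Z + K%:Z * (m + K%:Z) < n) -> blackz P m n.
Proof.
move=> nvP m0 hn.
pose rel P Q := if `[< HF N P >] then `[< HF N Q >] && (hmin Q < hmin P)%N
  else `[< HF N Q >] || `[< SF N Q >] && ((lam P < lam Q) || (lam Q == lam P) && (hi P < hi Q)).
pose cnt P : R := #|rel P|%:R.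
have cK : cnt P <= K%:R by rewrite ler_nat max_card.
have c0 : 0 <= cnt P by [].
have ordHH Q Q' : HF N Q -> HF N Q' -> (hmin Q' < hmin Q)%N -> cnt Q' <= cnt Q - 1.
  move=> hQ hQ' lt; rewrite lerBrDr natr1 ler_nat; apply: proper_card; apply/properP; split.
    apply/fintype.subsetP => q; rewrite !unfold_in /rel (asboolT hQ) (asboolT hQ') => /andP[-> /=].
    by move=> h; apply: ltn_trans lt.
  by exists Q'; rewrite unfold_in /rel ?(asboolT hQ) (asboolT hQ') //= ltnn.
have [hP|nhP] := pselect (HF N P).
  apply: (@HF_region R N cnt) => //.
  by move: hn; rewrite (asboolT hP) -(ltr_int R) -pmulrn; apply: le_lt_trans.
have sP : SF N P by [].
have [lK Kl] := SF_lam_bounds sP; have [_ l0] := (SFP R P).1 sP.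
apply: (@black_region R N cnt) => //.
- move=> Q Q' [nhQ _] hQ'; rewrite lerBrDr natr1 ler_nat; apply: proper_card; apply/properP; split.
    by apply/fintype.subsetP => q; rewrite !unfold_in /rel (asboolT hQ') (asboolF nhQ) => /andP[->].
  by exists Q'; rewrite unfold_in /rel ?(asboolF nhQ) (asboolT hQ') //= ltnn.
- move=> Q Q' sQ sQ' h; have [nhQ _] := sQ; have [nhQ' _] := sQ'.
  rewrite lerBrDr natr1 ler_nat; apply: proper_card; apply/properP; split.
    apply/fintype.subsetP => q; rewrite !unfold_in /rel (asboolF nhQ) (asboolF nhQ') => /orP[->//|/andP[-> h']].
    rewrite orbC /=; case: h h' => [lt|[-> lt]] /orP[h1|/andP[/eqP e h1]].
    - by rewrite (lt_trans lt h1).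
    - by rewrite e lt.
    - by rewrite h1.
    - by rewrite e eqxx (lt_trans lt h1) orbT.
  exists Q'; rewrite unfold_in /rel ?(asboolF nhQ) ?(asboolF nhQ') (asboolT sQ') //=; last first.
    by rewrite !ltxx !andbF.
  by case: h => [->//|[-> ->]]; rewrite eqxx orbT.
rewrite offset1; move: hn; rewrite (asboolF nhP) -(ltr_int R).
rewrite rmorphD rmorphM /= rmorphD /= -!pmulrn => h.
rewrite -(ler0z R) in m0; set c := cnt P in cK c0 *.
have h1 : K%:R * (m%:~R + c) < n%:~R - c.
  have : K%:R * (m%:~R + c) <= K%:R * (m%:~R + K%:R) :> R by rewrite ler_wpM2l ?lerD2l //.
  lra.
have h2 : lam P * (K%:R * (m%:~R + c)) < lam P * (n%:~R - c) by rewrite ltr_pM2l.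
have h3 : 1 * (m%:~R + c) <= (K%:R * lam P) * (m%:~R + c) by rewrite ler_wpM2r ?addr_ge0.
lra.
Qed.

(** White points of [HF] planes lie in rows up to [K], so some [t] in a short interval is not the
    first white column of any such row. Beyond this gap Spoiler would still win after a shift by one
    to the left: a play that leaves the region is, even shifted, right of the new frontier or in the
    range of [white_bound]. A frontier beyond the gap would thus contradict itself. *)
Lemma HF_bound P n : HF N P -> frontier P n <> +oo%E ->
  fr P n + 1 <= 3 * K%:Z * (K%:Z + 1) + 2.
Proof.
pose node := (plane N * 'I_K.+1)%type.
(* Planes outside [HF] are entered at rows up to [K + 1], where [white_bound] asks for columns
   beyond [2 * K * (K + 1)]; the [2] leaves room for the shift and one move. *)
pose b : int := 2 * K%:Z * (K%:Z + 1) + 2.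
have [t [tb tP]] := @missed_value node (fun x => fr x.1 x.2 + 1) b.
rewrite card_prod card_ord in tb.
have lowK Q m (k : int) : HF N Q -> 0 <= m -> 0 <= k -> ~ blackz Q m k -> k <= K%:Z.
  move=> hQ m0 k0 w; rewrite leNgt; apply/negP => lt; apply: w; apply: black_bound => //.
    by case.
  by rewrite asboolT.
have tP' Q (i : nat) : HF N Q -> frontier Q i <> +oo%E -> fr Q i + 1 <> t.
  move=> hQ nf e; have [_ f_ge h] := frP nf.
  have w : ~ blackz Q (fr Q i + 1) i by move=> /(h (fr Q i + 1) ltac:(lia)); lia.
  have le := lowK Q (fr Q i + 1) i hQ ltac:(lia) isT w.
  have lt : (i < K.+1)%N by lia.
  exact: (tP (Q, Ordinal lt)).
have claim k : forall Q m (i : nat), HF N Q -> 0 <= m -> t < fr Q i + 1 -> ~ survives k Q m i ->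
    ~ blackz Q (m - 1) i.
  elim: k => [|k IH] Q m i hQ m0 tf wk; first by case: wk; split.
  have w := not_survives_white wk.
  have nf : frontier Q i <> +oo%E by move=> /frontier_infty h; apply: w.
  have [_ f_ge h] := frP nf.
  have mf : fr Q i < m by rewrite ltNge; apply/negP => /(h _ m0).
  have [//|a [d [p' [r md hs]]]] := not_survives_step _ wk.
  have bd := effect_bound r; have t0 : 2 <= t by rewrite /b in tb; nia.
  move=> B; have [|d' [q' [r' B']]] := blackz_step B r; first by lia.
  have bd' := effect_bound r'; have n0 := blackz_ge0 B'; have w' := hs _ _ r'.
  pose Q' := (p', q'); pose i' : nat := absz (i%:Z + d').
  have iE : i%:Z + d' = i'%:Z by rewrite /i'; lia.
  rewrite iE in B' w'; have iK := lowK Q m i hQ m0 isT w.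
  have m1 : 0 <= m - 1 + d by lia.
  have [hQ'|nhQ'] := pselect (HF N Q'); last first.
    have iK' : i'%:Z <= K%:Z + 1 by lia.
    apply: (white_bound nhQ' m1 _ _ B') => //; case: ifP => _; rewrite /b in tb; nia.
  have nf' : frontier Q' i' <> +oo%E by move=> /frontier_infty h'; apply: (not_survives_white w').
  have [_ f_ge' h'] := frP nf'; have ne := tP' Q' i' hQ' nf'.
  have [lt|le] := ltP t (fr Q' i' + 1).
    by apply: (IH Q' (m + d) i' hQ' md lt w'); have -> : m + d - 1 = m - 1 + d by lia.
  by have := (h' _ m1).1 B'; lia.
move=> hP nf; have [_ f_ge h] := frP nf.
have t0 : 2 <= t by rewrite /b in tb; nia.
have [lt|le] := ltP t (fr P n + 1); last by rewrite /b in tb; nia.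
have w : ~ blackz P (fr P n + 1) n by move=> /(h (fr P n + 1) ltac:(lia)); lia.
have [k wk] := whiteP w.
case: (claim k P (fr P n + 1) n hP ltac:(lia) lt wk).
by rewrite addrK; apply/h; lia.
Qed.

(** The gap argument with rows and columns exchanged: [u] gives the least black row of a column,
    black points of [VF] planes have columns up to [K], and beyond a gap Duplicator survives a shift
    down by one. *)
Lemma VF_bound P m n n' : VF N P -> 0 <= m -> blackz P m n'%:Z -> ~ blackz P m n%:Z ->
  n%:Z <= 3 * K%:Z * (K%:Z + 1) + 2.
Proof.
have /choice[u uP] : forall x : plane N * nat, exists u : nat, (exists n : nat, blackz x.1 x.2%:Z n) ->
    blackz x.1 x.2%:Z u /\ forall n : nat, blackz x.1 x.2%:Z n -> (u <= n)%N.
  move=> x; have [[n0 b0]|h] := pselect (exists n : nat, blackz x.1 x.2%:Z n); last by exists 0%N.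
  have ex : exists n, `[< blackz x.1 x.2%:Z n%:Z >] by exists n0; apply/asboolP.
  have [i /asboolP bi mini] := ex_minnP ex.
  by exists i => _; split=> // j bj; apply: mini; apply/asboolP.
pose node := (plane N * 'I_K.+1)%type.
pose b : int := K%:Z + K%:Z * (2 * K%:Z + 1) + 2.
have [t [tb tP]] := @missed_value node (fun x => (u (x.1, x.2 : nat))%:Z) b.
rewrite card_prod card_ord in tb.
have K0 : 0 <= K%:Z by [].
have t0 : 2 <= t by rewrite /b in tb; nia.
have mK Q k (i : nat) : VF N Q -> 0 <= k -> blackz Q k i -> k <= K%:Z.
  move=> vQ k0 B; rewrite leNgt; apply/negP => lt.
  by apply: (@white_bound Q k i) => //; [case: vQ | rewrite asboolT].
have uE Q k (i : nat) : VF N Q -> 0 <= k -> blackz Q k i ->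
    [/\ blackz Q k (u (Q, absz k)), (u (Q, absz k) <= i)%N & (u (Q, absz k))%:Z <> t].
  move=> vQ k0 B; have kE : (absz k)%:Z = k by lia.
  have [|h1 h2] := uP (Q, absz k); first by exists i; rewrite /= kE.
  rewrite /= kE in h1 h2; split=> //; first exact: h2.
  have lt : (absz k < K.+1)%N by have := mK Q k i vQ k0 B; lia.
  exact: (tP (Q, Ordinal lt)).
(* The second case is the shifted play beyond the gap. When the play enters a column with [u] at
   most [t], the missed value makes [u] smaller than [t], so the shifted point itself is black. *)
pose S Q k (i : int) := blackz Q k i \/
  [/\ VF N Q, 0 <= k, blackz Q k (i + 1) & t < (u (Q, absz k))%:Z].
have coind : forall Q k (i : int), S Q k i -> blackz Q k i.
  apply: black_coind => Q k i [B|[vQ k0 B ut]].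
    split; first exact: blackz_ge0 B.
    move=> a d p' r md; have [d' [q' [r' B']]] := blackz_step B r md.
    by exists d', q'; split=> //; left.
  have i0 := blackz_ge0 B; pose i1 : nat := absz (i + 1).
  have iE : i + 1 = i1%:Z by rewrite /i1; lia.
  have [_ ui _] := uE Q k i1 vQ k0 ltac:(by rewrite -iE).
  have kK := mK Q k i1 vQ k0 ltac:(by rewrite -iE).
  split; first by lia.
  move=> a d p' r md; have [d' [q' [r' B']]] := blackz_step B r md.
  have bd := effect_bound r; have bd' := effect_bound r'.
  exists d', q'; split=> //; pose Q' := (p', q').
  have [vQ'|nvQ'] := pselect (VF N Q'); last first.
    left; apply: black_bound => //; case: ifP => _; rewrite /b in tb; first by nia.
    have : K%:Z * (k + d + K%:Z) <= K%:Z * (2 * K%:Z + 1) by rewrite ler_wpM2l //; lia.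
    lia.
  have n0 := blackz_ge0 B'; pose i2 : nat := absz (i + 1 + d').
  have iE2 : i + 1 + d' = i2%:Z by rewrite /i2; lia.
  rewrite iE2 in B'; have [h1 h2 h3] := uE Q' (k + d) i2 vQ' md B'.
  have [lt|le] := ltP t (u (Q', absz (k + d)))%:Z.
    by right; split=> //; have -> : i + d' + 1 = i2%:Z by lia.
  left; move: (u (Q', absz (k + d))) h1 h2 h3 le => U h1 h2 h3 le.
  by apply: blackz_mono h1 => //; lia.
move=> vP m0 B w; have [h1 h2 h3] := uE P m n' vP m0 B.
have nu : (n < u (P, absz m))%N.
  by rewrite ltnNge; apply/negP => le; apply: w; apply: blackz_mono h1.
have [lt|le] := ltP t (u (P, absz m))%:Z; last first.
  have eb : b + (K * K.+1)%N%:Z = 3 * K%:Z * (K%:Z + 1) + 2 by rewrite /b; nia.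
  by rewrite eb in tb; lia.
have B1 : blackz P m ((u (P, absz m))%:Z - 1).
  by apply: coind; right; split=> //; rewrite subrK.
have u0 : (0 < u (P, absz m))%N by lia.
have uS : (u (P, absz m))%:Z - 1 = (u (P, absz m)).-1%:Z by lia.
rewrite uS in B1; have [_ h4 _] := uE P m _ vP m0 B1; lia.
Qed.

Lemma VF_maximum P n : VF N P -> (frontier P n < maximum 0%E (range (@frontier N P)))%E ->
  exists n', fr P n < fr P n'.
Proof.
move=> vP; have [nhP [c cP]] := vP.
have fE i : frontier P i = (fr P i)%:E by have [] := frP (@not_HFP N P nhP i).
(* Adding [1] turns the frontier values into natural numbers. *)
pose S := [set i : nat | exists n, fr P n + 1 = i%:Z].
have [||i [[n1 e1] maxi]] := @nat_set_max S (absz (c + 1)).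
- by exists (absz (fr P 0%N + 1)), 0%N; have := fr_ge 0%N nhP; lia.
- by move=> i [k e]; have := cP k; rewrite fE lee_fin; lia.
have : (range (@frontier N P) `&` ubound (range (@frontier N P))) (maximum 0%E (range (@frontier N P))).
  apply: (xgetPex 0%E); exists (frontier P n1); split; first by exists n1.
  move=> _ [k _ <-]; rewrite !fE lee_fin; have := fr_ge k nhP => f_ge.
  by have := maxi (absz (fr P k + 1)) ltac:(by exists k; lia); lia.
by move=> [[k _ <-] _]; rewrite !fE lte_fin => lt; exists k.
Qed.

End PolynomialBounds.

Theorem theorem5 (R : realType) :
  (forall N : ocn,
     [/\ forall P : plane N, SF N P ->
           exists dx dy : nat,
             [/\ (1 <= dx <= #|planes_ms R N (alpha R P)|)%N,
                 (1 <= dy <= #|planes_ms R N (alpha R P)|)%N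
               & alpha R P = ((dy%:R / dx%:R : rat)%:E)],
         forall (z : nat) (s : z.-tuple (plane N)),
           uniq s -> [set` s] = VF N `|` SF N -> sorted (leL R (N := N)) s ->
           forall i : 'I_z,
             rnb (nclasses (eqvL R (N := N)) s i.+1) (ell R (tnth s i))
               `<=` white (tnth s i)
       & forall (z : nat) (s : z.-tuple (plane N)),
           uniq s -> [set` s] = HF N `|` SF N -> sorted (leR R (N := N)) s ->
           forall i : 'I_z,
             lnb (nclasses (eqvR R (N := N)) s i.+1) (ell R (tnth s i))
               `<=` black (tnth s i)])
  /\ (exists pol : {poly int}, forall (N : ocn) (P : plane N) (n : nat),
        (HF N P -> (frontier P n < +oo)%E ->
           (frontier P n <= (pol.[#|states N|%:R])%:E)%E)
        /\ (VF N P ->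
             (frontier P n < maximum 0%E (range (@frontier N P)))%E ->
             n%:Z <= pol.[#|states N|%:R])).
Proof.
split=> [N|].
  split=> [P sP|z s us es srt i|z s us es srt i].
  - have [dx [dy [x_bound y_bound e]]] := slope_quotient R sP.
    exists dx, dy; split=> //; apply: alpha_quotient => //.
    by case/andP: x_bound.
  - have idx : index (tnth s i) s = i by rewrite (tnth_nth (tnth s i)) index_uniq ?size_tuple.
    rewrite -[i.+1]/((i : nat).+1) -[X in nclasses _ _ X.+1]idx; apply: rnb_white => //.
      by move=> Q; rewrite -(VF_or_SF R Q) -es.
    exact: mem_tnth.
  have idx : index (tnth s i) s = i by rewrite (tnth_nth (tnth s i)) index_uniq ?size_tuple.
  rewrite -[X in nclasses _ _ X.+1]idx; apply: lnb_black => //.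
    by move=> Q; rewrite -[HF N Q \/ SF N Q]/((HF N `|` SF N) Q) -es.
  exact: mem_tnth.
(* The number of planes is the square of the number of states; substituting it into
   [3 * K * (K + 1) + 2] gives this polynomial. *)
exists (3 *: 'X^4 + 3 *: 'X^2 + 2%:P) => N P n.
have -> : (3 *: 'X^4 + 3 *: 'X^2 + 2%:P : {poly int}).[#|states N|%:R] =
    3 * #|plane N|%:Z * (#|plane N|%:Z + 1) + 2.
  by rewrite !hornerE card_prod PoszM !natz; ring.
split=> [hP lt|vP /(VF_maximum vP)[n' lt]].
  have nf : frontier P n <> +oo%E by move=> e; rewrite e ltxx in lt.
  have [-> _ _] := frP nf; rewrite lee_fin.
  by have := HF_bound R hP nf; move: (fr P n) => x; lia.
have [nhP _] := vP; have f_ge := fr_ge n nhP.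
have f0 : 0 <= fr P n' by lia.
apply: (@VF_bound R N P (fr P n') n n') => //.
  exact/(blackz_fr n' nhP f0).
by move=> /(blackz_fr n nhP f0); lia.
Qed.
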